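(* Let $\rho,\gamma\ge1$. A (polynomial-time) $(\rho,\gamma)$-tree approximation algorithm for the path-orienteering problem can be used to obtain an $O(\rho\gamma)$-approximation algorithm for the minimum latency problem (ML). Likewise, a (polynomial-time) $(\rho,\gamma)$-tree approximation algorithm for the group orienteering problem can be used to obtain an $O(\rho\gamma)$-approximation algorithm for the minimum group latency problem (MGL).
   Context: ML: given the complete graph on $\mathcal D\cup\{r\}$ with metric edge weights, find a path starting at $r$ visiting all nodes of $\mathcal D$ that minimizes the sum over $j\in\mathcal D$ of the length of the path from $r$ to $j$. MGL: given a metric $d$ on $\mathcal F\cup\{r\}$ and groups $G_1,\dots,G_m\subseteq\mathcal F$, find a path starting at $r$ minimizing the sum over $j$ of the length of the path from $r$ to the first visited node of $G_j$. Path-orienteering: given metric edge lengths, a root $r$, nonnegative node rewards and a length bound $B$, find a simple path starting at $r$ of length at most $B$ gathering maximum total reward. Group orienteering: the same with a nonnegative reward for each group $G_j$, collected if the path contains at least one node of $G_j$. A $(\rho,\gamma)$-tree approximation algorithm for either problem is an algorithm that always returns a tree containing $r$, of total length at most $\gamma B$, gathering reward at least $1/\rho$ times the optimum reward (the optimum being over paths from $r$ of length at most $B$). The approximation algorithms for ML and MGL may be randomized, with the guarantee holding in expectation. *)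

(* Defs.v *)
From HB Require Import structures.
From mathcomp Require Import all_boot all_order all_algebra.
From mathcomp Require Import reals.

Set Implicit Arguments.
Unset Strict Implicit.
Unset Printing Implicit Defensive.

Import Order.TTheory GRing.Theory Num.Theory.

Local Open Scope ring_scope.

(** * Algorithms and their running time

   Programs are written in a first-order recursive language over binary trees
   with rational leaves.  Every primitive operation is charged the bit size of
   its operands and of its result, so that, up to a polynomial, running time is
   Turing-machine time. *)

Inductive data : Type :=
  | Num of rat
  | Nil
  | Cons of data & data.

Definition bitlen (n : nat) : nat := (trunc_log 2 n).+1.

Fixpoint dsize (v : data) : nat :=
  match v with
  | Num q => (bitlen `|numq q| + bitlen `|denq q|)%N
  | Nil => 1%N
  | Cons a b => (dsize a + dsize b).+1
  end.

(* [Nil] is false, anything else is true. *)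
Definition enc_bool (b : bool) : data := if b then Num 1 else Nil.

Inductive op1 : Type := Car | Cdr | IsNum | Floor.
Inductive op2 : Type := Pair | Add | Sub | Mul | Div | Le.

(* Ill-typed operations return [Nil]; division by 0 returns 0. *)
Definition app1 (o : op1) (v : data) : data :=
  match o, v with
  | Car, Cons a _ => a
  | Cdr, Cons _ b => b
  | IsNum, Num _ => enc_bool true
  | Floor, Num q => Num (Num.floor q)%:~R
  | _, _ => Nil
  end.

Definition app2 (o : op2) (u v : data) : data :=
  match o, u, v with
  | Pair, _, _ => Cons u v
  | Add, Num p, Num q => Num (p + q)
  | Sub, Num p, Num q => Num (p - q)
  | Mul, Num p, Num q => Num (p * q)
  | Div, Num p, Num q => Num (p / q)
  | Le, Num p, Num q => enc_bool (p <= q)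
  | _, _, _ => Nil
  end.

Inductive expr : Type :=
  | Var of nat                  (* de Bruijn index *)
  | Lit of data
  | Op1 of op1 & expr
  | Op2 of op2 & expr & expr
  | Let of expr & expr
  | If of expr & expr & expr
  | Call of nat & expr          (* call a function of the same program *)
  | Ask of expr                 (* call the subroutine *)
  | Flip.                       (* toss a fair coin *)

(* A program is a table of unary functions; function 0 is the entry point. *)
Definition code : Type := seq expr.

(* [b x w y w' t]: on input [x] and coin tosses [w], the output is [y], the
   tosses [w'] are left unread, and the running time is [t]. *)
Definition behaviour : Type :=
  data -> seq bool -> data -> seq bool -> nat -> Prop.

(* Big-step semantics of the program [p] with subroutine [sub]; the time spent
   in the subroutine is charged to the caller. *)
Inductive eval (sub : behaviour) (p : code) :
    seq data -> expr -> seq bool -> data -> seq bool -> nat -> Prop :=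
  | EvalVar env i w :
      eval sub p env (Var i) w (nth Nil env i) w 1
  | EvalLit env v w :
      eval sub p env (Lit v) w v w (dsize v)
  | EvalOp1 env o e w v w1 t :
      eval sub p env e w v w1 t ->
      eval sub p env (Op1 o e) w (app1 o v) w1
        (t + dsize v + dsize (app1 o v)).+1
  | EvalOp2 env o e1 e2 w v1 w1 t1 v2 w2 t2 :
      eval sub p env e1 w v1 w1 t1 ->
      eval sub p env e2 w1 v2 w2 t2 ->
      eval sub p env (Op2 o e1 e2) w (app2 o v1 v2) w2
        (t1 + t2 + dsize v1 + dsize v2 + dsize (app2 o v1 v2)).+1
  | EvalLet env e1 e2 w v1 w1 t1 v2 w2 t2 :
      eval sub p env e1 w v1 w1 t1 ->
      eval sub p (v1 :: env) e2 w1 v2 w2 t2 ->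
      eval sub p env (Let e1 e2) w v2 w2 (t1 + t2).+1
  | EvalIfTrue env e1 e2 e3 w v1 w1 t1 v w2 t2 :
      eval sub p env e1 w v1 w1 t1 -> v1 <> Nil ->
      eval sub p env e2 w1 v w2 t2 ->
      eval sub p env (If e1 e2 e3) w v w2 (t1 + t2).+1
  | EvalIfFalse env e1 e2 e3 w w1 t1 v w2 t2 :
      eval sub p env e1 w Nil w1 t1 ->
      eval sub p env e3 w1 v w2 t2 ->
      eval sub p env (If e1 e2 e3) w v w2 (t1 + t2).+1
  | EvalCall env f e w x w1 t1 v w2 t2 :
      eval sub p env e w x w1 t1 ->
      eval sub p [:: x] (nth (Lit Nil) p f) w1 v w2 t2 ->
      eval sub p env (Call f e) w v w2 (t1 + t2).+1
  | EvalAsk env e w x w1 t1 v w2 t2 :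
      eval sub p env e w x w1 t1 ->
      sub x w1 v w2 t2 ->
      eval sub p env (Ask e) w v w2 (t1 + t2).+1
  | EvalFlip env b w :
      eval sub p env Flip (b :: w) (enc_bool b) w 1.

Inductive algorithm : Type :=
  | Closed of code
  | Using of code & algorithm.  (* the program, with the algorithm as subroutine *)

Definition run (sub : behaviour) (p : code) : behaviour :=
  fun x => eval sub p [:: x] (nth (Lit Nil) p 0).

Fixpoint exec (A : algorithm) : behaviour :=
  match A with
  | Closed p => run (fun _ _ _ _ _ => False) p
  | Using p A' => run (exec A') p
  end.

(* Polynomial time on the inputs satisfying [valid], whatever the coin tosses
   (a run of length at most T reads at most T of them). *)
Definition polytime (valid : data -> Prop) (A : algorithm) : Prop :=
  exists c k : nat, forall x : data, valid x ->
    let T := (c * dsize x ^ k + c)%N in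
    forall w : T.-tuple bool, exists y w' t, exec A x w y w' t /\ (t <= T)%N.

(** * Metrics, paths, trees

   The nodes are ['I_n.+1]; the root r is [ord0], and the other nodes form the
   set D (for the latency problem) or F (for the group version). *)

Definition is_metric (n : nat) (d : 'M[rat]_n) : Prop :=
  [/\ forall u v, 0 <= d u v,
      forall u v, (d u v == 0) = (u == v),
      forall u v, d u v = d v u &
      forall u v x, d u x <= d u v + d v x].

Section Graph.
Variable n : nat.
Local Notation node := 'I_n.+1.
Variable d : 'M[rat]_n.+1.

Fixpoint walk_len (u : node) (p : seq node) : rat :=
  if p is v :: p' then d u v + walk_len v p' else 0.

(* [p] lists the nodes of a path after its starting point r. *)
Definition simple_path (p : seq node) : bool := uniq (ord0 :: p).

(* Length of the path from r to its first node satisfying [P]. *)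
Definition arrival (p : seq node) (P : pred node) : rat :=
  walk_len ord0 (take (find P (ord0 :: p)) p).

Definition adj (E : seq (node * node)) : rel node :=
  fun u v => ((u, v) \in E) || ((v, u) \in E).

Definition tree_nodes (E : seq (node * node)) : seq node :=
  ord0 :: unzip1 E ++ unzip2 E.

(* A tree containing r, given by the list of its edges: a simple graph that is
   connected and has no cycle. *)
Definition is_tree (E : seq (node * node)) : Prop :=
  [/\ all (fun e => e.1 != e.2) E,
      uniq [seq [set e.1; e.2] | e <- E],
      {in tree_nodes E, forall v, connect (adj E) ord0 v} &
      forall c : seq node, ucycle (adj E) c -> (size c <= 2)%N].

Definition tree_len (E : seq (node * node)) : rat := \sum_(e <- E) d e.1 e.2.

End Graph.

(** * Orienteering *)

Section Orienteering.
Variables (n : nat) (d : 'M[rat]_n.+1) (B : rat).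
Local Notation node := 'I_n.+1.
(* total reward of a path or tree, as a function of the nodes it contains *)
Variable reward : seq node -> rat.

Definition orient_feasible (p : seq node) : Prop :=
  simple_path p /\ walk_len d ord0 p <= B.

Definition orient_optimal (p : seq node) : Prop :=
  orient_feasible p /\
  forall q, orient_feasible q -> reward (ord0 :: q) <= reward (ord0 :: p).

Definition tree_solution (R : realType) (rho gamma : R)
    (E : seq (node * node)) : Prop :=
  [/\ is_tree E, ratr (tree_len d E) <= gamma * ratr B &
      forall p, orient_optimal p ->
        rho^-1 * ratr (reward (ord0 :: p)) <= ratr (reward (tree_nodes E))].
End Orienteering.

Definition node_reward (n : nat) (w : 'I_n.+1 -> rat) (s : seq 'I_n.+1) : rat :=
  \sum_(v | v \in s) w v.

Definition group_reward (n m : nat) (G : 'I_m -> {set 'I_n.+1})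
    (w : 'I_m -> rat) (s : seq 'I_n.+1) : rat :=
  \sum_(j | has (mem (G j)) s) w j.

(** * Latency *)

Definition optimal (S : Type) (feasible : S -> Prop) (cost : S -> rat) (p : S) :
    Prop :=
  feasible p /\ forall q, feasible q -> cost p <= cost q.

Definition ml_feasible (n : nat) (p : seq 'I_n.+1) : Prop :=
  simple_path p /\ forall v, v \in ord0 :: p.

Definition ml_latency (n : nat) (d : 'M[rat]_n.+1) (p : seq 'I_n.+1) : rat :=
  \sum_(v : 'I_n.+1 | v != ord0) arrival d p (pred1 v).

Definition mgl_feasible (n m : nat) (G : 'I_m -> {set 'I_n.+1})
    (p : seq 'I_n.+1) : Prop :=
  simple_path p /\ forall j, has (mem (G j)) (ord0 :: p).

Definition mgl_latency (n m : nat) (d : 'M[rat]_n.+1)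
    (G : 'I_m -> {set 'I_n.+1}) (p : seq 'I_n.+1) : rat :=
  \sum_j arrival d p (mem (G j)).

(** * Encodings *)

Definition enc_seq (T : Type) (f : T -> data) (s : seq T) : data :=
  foldr (fun x v => Cons (f x) v) Nil s.

Definition enc_ord (n : nat) (i : 'I_n) : data := Num (i : nat)%:R.

Definition enc_fun (n : nat) (f : 'I_n -> data) : data := enc_seq f (enum 'I_n).

Definition enc_mx (n : nat) (d : 'M[rat]_n) : data :=
  enc_fun (fun i => enc_fun (fun j => Num (d i j))).

Definition enc_set (n : nat) (S : {set 'I_n}) : data :=
  enc_seq (@enc_ord n) (enum S).

Definition enc_path (n : nat) (p : seq 'I_n.+1) : data :=
  enc_seq (@enc_ord n.+1) (ord0 :: p).

Definition enc_edges (n : nat) (E : seq ('I_n.+1 * 'I_n.+1)) : data :=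
  enc_seq (fun e => Cons (enc_ord e.1) (enc_ord e.2)) E.

Definition enc_ml (n : nat) (d : 'M[rat]_n.+1) : data := enc_mx d.

Definition enc_mgl (n m : nat) (d : 'M[rat]_n.+1) (G : 'I_m -> {set 'I_n.+1}) :
    data :=
  Cons (enc_mx d) (enc_fun (fun j => enc_set (G j))).

Definition enc_po (n : nat) (d : 'M[rat]_n.+1) (w : 'I_n.+1 -> rat) (B : rat) :
    data :=
  Cons (enc_mx d) (Cons (enc_fun (fun v => Num (w v))) (Num B)).

Definition enc_go (n m : nat) (d : 'M[rat]_n.+1) (G : 'I_m -> {set 'I_n.+1})
    (w : 'I_m -> rat) (B : rat) : data :=
  Cons (enc_mx d)
    (Cons (enc_fun (fun j => Cons (enc_set (G j)) (Num (w j)))) (Num B)).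

(** * Instances *)

Definition ml_instance (n : nat) (d : 'M[rat]_n.+1) : Prop := is_metric d.

(* With an empty group no path would be feasible. *)
Definition mgl_instance (n m : nat) (d : 'M[rat]_n.+1)
    (G : 'I_m -> {set 'I_n.+1}) : Prop :=
  [/\ is_metric d, forall j, ord0 \notin G j & forall j, G j != set0].

Definition po_instance (n : nat) (d : 'M[rat]_n.+1) (w : 'I_n.+1 -> rat)
    (B : rat) : Prop :=
  [/\ is_metric d, forall v, 0 <= w v & 0 <= B].

Definition go_instance (n m : nat) (d : 'M[rat]_n.+1)
    (G : 'I_m -> {set 'I_n.+1}) (w : 'I_m -> rat) (B : rat) : Prop :=
  [/\ is_metric d, forall j, ord0 \notin G j, forall j, 0 <= w j & 0 <= B].

Definition ml_input (x : data) : Prop :=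
  exists (n : nat) (d : 'M[rat]_n.+1), ml_instance d /\ x = enc_ml d.

Definition mgl_input (x : data) : Prop :=
  exists (n m : nat) (d : 'M[rat]_n.+1) (G : 'I_m -> {set 'I_n.+1}),
    mgl_instance d G /\ x = enc_mgl d G.

Definition po_input (x : data) : Prop :=
  exists (n : nat) (d : 'M[rat]_n.+1) (w : 'I_n.+1 -> rat) (B : rat),
    po_instance d w B /\ x = enc_po d w B.

Definition go_input (x : data) : Prop :=
  exists (n m : nat) (d : 'M[rat]_n.+1) (G : 'I_m -> {set 'I_n.+1})
         (w : 'I_m -> rat) (B : rat),
    go_instance d G w B /\ x = enc_go d G w B.

(** * Approximation guarantees *)

(* Whatever the coin tosses, [A] halts on [x] and outputs the code of some
   [y] satisfying [good]. *)
Definition always_outputs (S : Type) (A : algorithm) (x : data)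
    (enc : S -> data) (good : S -> Prop) : Prop :=
  exists T : nat, forall w : T.-tuple bool, exists y w' t,
    exec A x w (enc y) w' t /\ good y.

(* [A] halts on [x], always outputs a feasible solution, and the expectation of
   its cost over the coin tosses is at most [alpha] times the minimum cost. *)
Definition approximates (R : realType) (alpha : R) (S : Type) (A : algorithm)
    (x : data) (enc : S -> data) (feasible : S -> Prop) (cost : S -> rat) :
    Prop :=
  exists (T : nat) (out : T.-tuple bool -> S),
    (forall w : T.-tuple bool, feasible (out w) /\
       exists w' t, exec A x w (enc (out w)) w' t) /\
    forall p, optimal feasible cost p ->
      (\sum_(w : T.-tuple bool) ratr (cost (out w))) / 2 ^+ T
        <= alpha * ratr (cost p).

Definition po_tree_approx (R : realType) (rho gamma : R) (A : algorithm) :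
    Prop :=
  forall (n : nat) (d : 'M[rat]_n.+1) (w : 'I_n.+1 -> rat) (B : rat),
    po_instance d w B ->
    always_outputs A (enc_po d w B) (@enc_edges n)
      (tree_solution d B (node_reward w) rho gamma).

Definition go_tree_approx (R : realType) (rho gamma : R) (A : algorithm) :
    Prop :=
  forall (n m : nat) (d : 'M[rat]_n.+1) (G : 'I_m -> {set 'I_n.+1})
         (w : 'I_m -> rat) (B : rat),
    go_instance d G w B ->
    always_outputs A (enc_go d G w B) (@enc_edges n)
      (tree_solution d B (group_reward G w) rho gamma).

Definition ml_approx (R : realType) (alpha : R) (A : algorithm) : Prop :=
  forall (n : nat) (d : 'M[rat]_n.+1), ml_instance d ->
    approximates alpha A (enc_ml d) (@enc_path n)
      (@ml_feasible n) (ml_latency d).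

Definition mgl_approx (R : realType) (alpha : R) (A : algorithm) : Prop :=
  forall (n m : nat) (d : 'M[rat]_n.+1) (G : 'I_m -> {set 'I_n.+1}),
    mgl_instance d G ->
    approximates alpha A (enc_mgl d G) (@enc_path n)
      (mgl_feasible G) (mgl_latency d G).

(* Main.v *)
(* Fix a natural number N >= rho. Phase t calls the tree algorithm with the
   bound B_t = b0 (1 + 1/(2N))^t, where b0 is at most every distance from the
   root, and with reward 1 on the groups not reached yet. The edges of the
   tree are turned into a closed tour of at most twice its length (an edge uv
   with u on the tour and v off it inserts v right after u), which is shortcut
   and appended to the current path. If R_t groups are unreached before phase
   t and n_t groups have latency above B_t in a fixed solution, then N R_(t+1)
   <= (N - 1) R_t + n_t. A group unreached before phase t pays at most 2 gamma
   B_t for that phase, so the latency is at most 2 gamma sum R_t B_t. The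
   recurrence bounds sum R_t B_t by 2N R_0 b0 + 3 sum n_t B_t, and sum n_t B_t
   is O(N) times the latency of the fixed solution by summing a geometric
   series for every group: one constant factor per phase replaces both the
   usual doubling of the bound and the O(rho) repetitions of each phase. Once
   B_t exceeds the length of a path through all nodes every phase reaches a
   new group, so the number of phases is polynomial. ML is the case of
   singleton groups. *)

Require Import Defs.
From mathcomp Require Import all_boot all_order all_algebra.
From mathcomp Require Import boolp reals.
From mathcomp Require Import zify ring lra.
(* Restores the constructor [Var], shadowed by algebra-tactics. *)
Import Defs.

Set Implicit Arguments.
Unset Strict Implicit.
Unset Printing Implicit Defensive.

Import Order.TTheory GRing.Theory Num.Theory.

Local Open Scope ring_scope.

(** * Evaluation *)

(** The factor 1 + 1/(2N) balances two geometric sums. Late groups apart, a phase multiplies the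
    number of unreached groups by at most 1 - 1/N, so R_t B_t still decays at rate 1 - 1/(2N) and
    sums to 2N times its first value; and the scales below a given latency also sum to O(N) times
    that latency. Doubling the bound instead would require each phase to leave well under half of
    the groups. Rounding rho up to an integer N makes the factor a rational literal, so the program
    is fixed before the subroutine is known.

    The other obstacle is the machine model. The quality guarantee of the subroutine and its time
    bound may concern tapes of different lengths; determinism and the irrelevance of unread tosses
    bring them to a common tape. Outside subroutine calls no coin is tossed, so the rest of the
    program is evaluated uniformly in the tape. Its list loops are right folds, costed by one lemma
    in terms of one size parameter. Multiplying the bound by a fixed rational adds a fixed number of
    bits, so polynomially many phases keep it of polynomial size. *)

Record regular (b : behaviour) : Prop := Regular {
  tape_cat : forall x w y w' t z, b x w y w' t -> b x (w ++ z) y (w' ++ z) t;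
  tape_used : forall x w y w' t, b x w y w' t -> (size w <= size w' + t)%N;
  deterministic : forall x w y1 w1 t1 y2 w2 t2,
    b x w y1 w1 t1 -> b x w y2 w2 t2 -> [/\ y1 = y2, w1 = w2 & t1 = t2] }.

(** Regularity lets a run be replayed on a longer tape, bounds the tosses read by the time spent,
    and identifies two runs on the same input and tape. The subroutine enters only at [Ask], where
    its own regularity is used. *)
Lemma run_regular (sub : behaviour) (p : code) :
  regular sub -> regular (run sub p).
Proof.
move=> [cat used det]; split; rewrite /run.
- move=> x w y w' t z; elim=> {x w y w' t}; try by econstructor; eauto.
- move=> x w y w' t; elim=> {x w y w' t} //=; try by intros; lia.
  by move=> env e w x w1 t1 v w2 t2 _ IH /used; lia.
- move=> x w y1 w1 t1 y2 w2 t2 H; move: y2 w2 t2.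
  by elim: H => {x w y1 w1 t1}; intros;
    match goal with H : eval _ _ _ _ _ _ _ _ |- _ => inversion H; subst end;
    repeat match goal with
    | IH : forall _ _ _, eval _ _ _ _ _ _ _ _ -> _, H : eval _ _ _ _ _ _ _ _ |- _ =>
        case: (IH _ _ _ H) => ? ? ?; subst; clear IH
    | H1 : sub _ _ _ _ _, H2 : sub _ _ _ _ _ |- _ =>
        case: (det _ _ _ _ _ _ _ _ H1 H2) => ? ? ?; subst; clear H1
    end.
Qed.

Lemma exec_regular (A : algorithm) : regular (exec A).
Proof.
by elim: A => [p|p A IH] /=; apply: run_regular.
Qed.

(** The tape comes back unchanged for every [w], so such an evaluation fits anywhere between two
    subroutine calls. [T] is only an upper bound, which spares tracking exact costs. *)
Definition silent (sub : behaviour) (p : code) env e v T : Prop :=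
  forall w, exists2 t, eval sub p env e w v w t & (t <= T)%N.

Section Silent.
Variables (sub : behaviour) (p : code).
Local Notation silent := (silent sub p).
Implicit Types (env : seq data) (e : expr) (v : data) (T : nat).

Lemma silent_le env e v T T' : silent env e v T -> (T <= T')%N -> silent env e v T'.
Proof. by move=> h le w; have [t ev le'] := h w; exists t => //; lia. Qed.

Lemma silent_var env i v : nth Nil env i = v -> silent env (Var i) v 1.
Proof. by move=> <- w; exists 1%N => //; constructor. Qed.

Lemma silent_lit env v : silent env (Lit v) v (dsize v).
Proof. by move=> w; exists (dsize v) => //; constructor. Qed.

(** [S] bounds the operand, so that a whole expression is costed with one size parameter instead of
    the sizes of its intermediate values. *)
Lemma silent_car env e a b T S : silent env e (Cons a b) T ->
  (dsize (Cons a b) <= S)%N -> silent env (Op1 Car e) a (T + 2 * S).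
Proof.
move=> h le w; have [t ev le'] := h w.
eexists; first exact: (EvalOp1 Car ev).
by move: le => /=; lia.
Qed.

Lemma silent_cdr env e a b T S : silent env e (Cons a b) T ->
  (dsize (Cons a b) <= S)%N -> silent env (Op1 Cdr e) b (T + 2 * S).
Proof.
move=> h le w; have [t ev le'] := h w.
eexists; first exact: (EvalOp1 Cdr ev).
by move: le => /=; lia.
Qed.

Lemma silent_op2 env o e1 e2 v1 v2 v T1 T2 S :
  silent env e1 v1 T1 -> silent env e2 v2 T2 -> app2 o v1 v2 = v ->
  ((dsize v1 + dsize v2 + dsize v).+1 <= S)%N ->
  silent env (Op2 o e1 e2) v (T1 + T2 + S).
Proof.
move=> h1 h2 <- le w; have [t1 ev1 le1] := h1 w; have [t2 ev2 le2] := h2 w.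
by eexists; [exact: (EvalOp2 o ev1 ev2) | lia].
Qed.

Lemma silent_let env e1 e2 v1 v2 T1 T2 :
  silent env e1 v1 T1 -> silent (v1 :: env) e2 v2 T2 ->
  silent env (Let e1 e2) v2 (T1 + T2).+1.
Proof.
move=> h1 h2 w; have [t1 ev1 le1] := h1 w; have [t2 ev2 le2] := h2 w.
by eexists; [exact: (EvalLet ev1 ev2) | lia].
Qed.

Lemma silent_if env e1 e2 e3 (b : bool) v1 v T1 T2 :
  silent env e1 v1 T1 -> (v1 <> Nil <-> b) ->
  silent env (if b then e2 else e3) v T2 -> silent env (If e1 e2 e3) v (T1 + T2).+1.
Proof.
move=> h1 hb h2 w; have [t1 ev1 le1] := h1 w; have [t2 ev2 le2] := h2 w.
case: b hb h2 ev2 => [hb _ ev2|hb _ ev2].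
  by eexists; [exact: (EvalIfTrue _ ev1 (hb.2 isT) ev2) | lia].
case: v1 h1 hb ev1 => [q||x y] h1 hb ev1; try by have: false by apply/hb.
by eexists; [exact: (EvalIfFalse _ ev1 ev2) | lia].
Qed.

Lemma silent_if_bool env e1 e2 e3 (b : bool) v T1 T2 :
  silent env e1 (enc_bool b) T1 -> silent env (if b then e2 else e3) v T2 ->
  silent env (If e1 e2 e3) v (T1 + T2).+1.
Proof. by move=> h1; apply: (silent_if h1); case: b {h1}. Qed.

Lemma silent_call env f e x v T1 T2 :
  silent env e x T1 -> silent [:: x] (nth (Lit Nil) p f) v T2 ->
  silent env (Call f e) v (T1 + T2).+1.
Proof.
move=> h1 h2 w; have [t1 ev1 le1] := h1 w; have [t2 ev2 le2] := h2 w.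
by eexists; [exact: (EvalCall ev1 ev2) | lia].
Qed.

End Silent.

(** * Sizes of coded lists and the cost of a fold *)

#[local] Arguments enc_seq : simpl never.

Lemma dsize_gt0 v : (0 < dsize v)%N.
Proof. by case: v. Qed.

Lemma enc_seq_cons (T : Type) (f : T -> data) x s :
  enc_seq f (x :: s) = Cons (f x) (enc_seq f s).
Proof. by []. Qed.

Lemma size_enc_seq (T : Type) (f : T -> data) s : (size s < dsize (enc_seq f s))%N.
Proof. by elim: s => // x s IH; rewrite enc_seq_cons /=; lia. Qed.

Lemma dsize_enc_seq (T : eqType) (f : T -> data) b s :
  {in s, forall x, (dsize (f x) <= b)%N} ->
  (dsize (enc_seq f s) <= size s * b.+1 + 1)%N.
Proof.
elim: s => // x s IH h; rewrite enc_seq_cons /=.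
have := h x (mem_head _ _); have: (dsize (enc_seq f s) <= size s * b.+1 + 1)%N.
  by apply: IH => y ys; apply: h; rewrite in_cons ys orbT.
by lia.
Qed.

Notation car := (Op1 Car).
Notation cdr := (Op1 Cdr).
Notation pair := (Op2 Pair).

(* The argument of the function is [Cons ctx l], with [l] the list to fold; in
   [step] variable 0 is the value of the recursive call and variable 1 the
   argument. *)
Definition foldr_body (f : nat) (base step : expr) : expr :=
  If (cdr (Var 0))
     (Let (Call f (pair (car (Var 0)) (cdr (cdr (Var 0))))) step)
     base.

Section Foldr.
Variables (sub : behaviour) (p : code).
Local Notation silent := (silent sub p).

(** [step] is evaluated at suffixes of [l] only, and its hypothesis receives the splitting of [l],
    so that sizes and memberships known for [l] pass to the suffix. *)
Lemma silent_foldr (f : nat) base step (T A : Type) (encT : T -> data)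
    (encA : A -> data) (h : T -> A -> A) (z : A) (ctx : data) (l : seq T)
    (S Tb Ts : nat) :
  nth (Lit Nil) p f = foldr_body f base step ->
  (dsize (Cons ctx (enc_seq encT l)) <= S)%N ->
  silent [:: Cons ctx Nil] base (encA z) Tb ->
  (forall s1 e s2, l = s1 ++ e :: s2 ->
     silent [:: encA (foldr h z s2); Cons ctx (enc_seq encT (e :: s2))] step
       (encA (foldr h z (e :: s2))) Ts) ->
  silent [:: Cons ctx (enc_seq encT l)] (nth (Lit Nil) p f) (encA (foldr h z l))
    ((size l).+1 * (Ts + Tb + 20 * S)).
Proof.
move=> Ef + hb; elim: l => [|e l IH] le hs; rewrite Ef.
  apply: silent_le; first apply: (silent_if_bool (b := false)).
  - by apply: silent_cdr; [apply: silent_var | exact: le].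
  - exact: hb.
  - by move: (dsize_gt0 ctx) le => /=; lia.
have le' : (dsize (Cons ctx (enc_seq encT l)) <= S)%N by move: le => /=; lia.
have {}IH := IH le' (fun s1 x s2 E =>
  hs (e :: s1) x s2 (f_equal (fun s => e :: s) E)).
rewrite enc_seq_cons in le *.
apply: silent_le.
  apply: (silent_if (b := true)).
  - by apply: silent_cdr; [apply: silent_var | exact: le].
  - by [].
  - apply: silent_let; last exact: (hs [::]).
    apply: silent_call; last exact: IH.
    apply: (silent_op2 (S := (2 * S)%N)).
    + by apply: silent_car; [apply: silent_var | exact: le].
    + apply: (silent_cdr (S := S)); first apply: (silent_cdr (S := S)).
      * exact: silent_var.
      * exact: le.
      * move: le => /=; lia.
    + by [].
    + by move: le => /=; lia.
by move: (dsize_gt0 ctx) le => /=; nia.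
Qed.

(** The length of the list is below [S], so a fold raises the degree of the cost of its step by one.
    The exponents in the later bounds are the nesting depths of folds plus one. *)
Lemma silent_foldr_pow (f : nat) base step (T A : Type) (encT : T -> data)
    (encA : A -> data) (h : T -> A -> A) (z : A) (ctx : data) (l : seq T)
    (S Tb Ts c k : nat) :
  nth (Lit Nil) p f = foldr_body f base step ->
  (dsize (Cons ctx (enc_seq encT l)) <= S)%N ->
  silent [:: Cons ctx Nil] base (encA z) Tb ->
  (forall s1 e s2, l = s1 ++ e :: s2 ->
     silent [:: encA (foldr h z s2); Cons ctx (enc_seq encT (e :: s2))] step
       (encA (foldr h z (e :: s2))) Ts) ->
  (Ts + Tb + 20 * S <= c * S ^ k)%N ->
  silent [:: Cons ctx (enc_seq encT l)] (nth (Lit Nil) p f) (encA (foldr h z l))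
    (c * S ^ k.+1).
Proof.
move=> Ef le hb hs leT; apply: silent_le (silent_foldr Ef le hb hs) _.
rewrite expnS mulnCA; apply: leq_mul leT.
by move: (size_enc_seq encT l) le => /=; lia.
Qed.

End Foldr.

(** * The program *)

Lemma bitlen_le n : (bitlen n <= n.+1)%N.
Proof.
rewrite /bitlen ltnS; case: (posnP n) => [->|n0]; first by rewrite trunc_log0.
by apply: leq_trans (trunc_logP (ltnSn 1) n0); apply: ltnW; apply: ltn_expl.
Qed.

Lemma bitlen1 : bitlen 1 = 1%N.
Proof. by rewrite /bitlen trunc_log1. Qed.

Lemma dsize_nat n : (dsize (Num n%:R) <= n.+2)%N.
Proof.
rewrite /= -[n%:R]/((Posz n)%:~R : rat) numq_int denq_int /= bitlen1.
by have := bitlen_le n; lia.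
Qed.

Lemma dsize_bool b : (dsize (enc_bool b) <= 3)%N.
Proof. by case: b => //; exact: (dsize_nat 1). Qed.

(** * The list functions of the program, on sequences of nodes *)

Section TypedFunctions.
Variable n : nat.
Local Notation node := 'I_n.+1.
Implicit Types (u v : node) (e : node * node) (W P : seq node).

(** The fold mirrors the program. Every occurrence of [u] receives a copy of [v], which is a single
    insertion on the duplicate-free lists where it is applied. *)
Definition insert_after u v W : seq node :=
  foldr (fun x r => if x == u then x :: v :: r else x :: r) [::] W.

Definition grow e W : seq node :=
  if e.1 \in W then if e.2 \in W then W else insert_after e.1 e.2 W
  else if e.2 \in W then insert_after e.2 e.1 W else W.

Definition pass (E : seq (node * node)) W : seq node := foldr grow W E.

(** Edges come in arbitrary order, so one pass may meet an edge before either of its ends is on the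
    tour. Each pass advances at least one step along every path from the root, hence one pass per
    node is enough. *)
Definition tour (E : seq (node * node)) : seq node :=
  foldr (fun (_ : node) W => pass E W) [:: ord0] (enum 'I_n.+1).

Definition extend P W : seq node := P ++ [seq v <- W | v \notin P].

Lemma size_insert_after u v W : (size (insert_after u v W) <= 2 * size W)%N.
Proof. by elim: W => //= x W IH; case: ifP => _ /=; lia. Qed.

Lemma insert_after_notin u v W : u \notin W -> insert_after u v W = W.
Proof.
elim: W => //= x W IH; rewrite in_cons negb_or eq_sym => /andP[/negPf -> /IH].
by move=> {1}->.
Qed.

Lemma mem_insert_after u v W x : u \in W ->
  (x \in insert_after u v W) = (x == v) || (x \in W).
Proof.
elim: W => //= y W IH; rewrite !in_cons [u == y]eq_sym.
case: (eqVneq y u) => [->|yu /= uW]; last first.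
  by rewrite in_cons IH // orbCA.
have [uW _|uW _] := boolP (u \in W); last rewrite insert_after_notin //.
  by rewrite !in_cons IH //; case: (x == u); case: (x == v).
by rewrite !in_cons orbCA.
Qed.

Lemma uniq_insert_after u v W : u \in W -> v \notin W -> uniq W ->
  uniq (insert_after u v W).
Proof.
elim: W => //= x W IH; rewrite !in_cons negb_or => uW /andP[vx vW] /andP[xW uqW].
case: (eqVneq x u) uW => [xu _|xu /= uW].
  rewrite -xu insert_after_notin //= in_cons negb_or eq_sym vx xW.
  by rewrite vW uqW.
rewrite mem_insert_after // negb_or [x == v]eq_sym vx xW.
exact: IH.
Qed.

Lemma uniq_grow e W : uniq W -> uniq (grow e W).
Proof.
rewrite /grow => uW; have [h1|h1] := boolP (e.1 \in W);
  have [h2|h2] := boolP (e.2 \in W) => //; exact: uniq_insert_after.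
Qed.

Lemma uniq_pass E W : uniq W -> uniq (pass E W).
Proof. by move=> uW; elim: E => //= e E; apply: uniq_grow. Qed.

Lemma uniq_tour E : uniq (tour E).
Proof.
by rewrite /tour; elim: (enum _) => // x s; rewrite [foldr _ _ _]/=; apply: uniq_pass.
Qed.

Lemma uniq_extend P W : uniq P -> uniq W -> uniq (extend P W).
Proof.
move=> uP uW; rewrite cat_uniq uP filter_uniq // andbT /=.
by apply/hasPn => v; rewrite mem_filter => /andP[].
Qed.

Lemma mem_extend P W v : (v \in extend P W) = (v \in P) || (v \in W).
Proof. by rewrite mem_cat mem_filter; case: (v \in P). Qed.

Lemma size_uniq_node W : uniq W -> (size W <= n.+1)%N.
Proof. by move=> /card_uniqP <-; apply: leq_trans (max_card _) _; rewrite card_ord. Qed.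

End TypedFunctions.

Notation acc := (Var 0).
Notation elt := (Op1 Car (Op1 Cdr (Var 1))).
Notation ctx := (Op1 Car (Var 1)).
Notation true_ := (Lit (Num 1)).

Definition same (a b : expr) : expr :=
  If (Op2 Le a b) (Op2 Le b a) (Lit Nil).

(* 1 is the main loop, on the state [((distances, groups), (B, P))]; 2 is
   membership, 3 [insert_after], 4 [pass], 5 [tour], 6 and 7 [extend], 8 tests
   whether [P] meets a group, 9 whether it misses one, 10 and 11 weight the groups
   by 1 or 0, 12 is the least positive entry, 13 and 14 list the singletons. *)
Definition table (init query : expr) (beta : rat) : code := [::
  Call 1 init;
  If (Call 9 (pair (cdr (cdr (Var 0))) (cdr (car (Var 0)))))
     (Let (Ask query)
        (Call 1 (pair (car (Var 1))
           (pair (Op2 Mul (Lit (Num beta)) (car (cdr (Var 1))))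
              (Call 7 (pair
                 (Call 6 (pair (cdr (cdr (Var 1)))
                    (Call 5 (pair (Var 0) (car (car (Var 1)))))))
                 (cdr (cdr (Var 1)))))))))
     (cdr (cdr (Var 0)));
  foldr_body 2 (Lit Nil) (If (same elt ctx) true_ acc);
  foldr_body 3 (Lit Nil)
    (If (same elt (car ctx)) (pair elt (pair (cdr ctx) acc)) (pair elt acc));
  foldr_body 4 (car (Var 0))
    (If (Call 2 (pair (car elt) acc))
        (If (Call 2 (pair (cdr elt) acc)) acc
            (Call 3 (pair elt acc)))
        (If (Call 2 (pair (cdr elt) acc))
            (Call 3 (pair (pair (cdr elt) (car elt)) acc)) acc));
  foldr_body 5 (Lit (Cons (Num 0) Nil)) (Call 4 (pair acc ctx));
  foldr_body 6 (Lit Nil) (If (Call 2 (pair elt ctx)) acc (pair elt acc));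
  foldr_body 7 (car (Var 0)) (pair elt acc);
  foldr_body 8 (Lit Nil) (If (Call 2 (pair elt ctx)) true_ acc);
  foldr_body 9 (Lit Nil) (If (Call 8 (pair ctx elt)) acc true_);
  foldr_body 10 (Lit Nil)
    (pair (pair elt (If (Call 8 (pair ctx elt)) (Lit (Num 0)) true_)) acc);
  foldr_body 11 (Lit Nil)
    (pair (If (Call 8 (pair ctx elt)) (Lit (Num 0)) true_) acc);
  foldr_body 12 true_
    (If (Op2 Le elt (Lit (Num 0))) acc (If (Op2 Le elt acc) elt acc));
  foldr_body 13 (Lit Nil)
    (pair (pair (Op2 Add true_ (car elt)) (Lit Nil)) acc);
  foldr_body 14 (Lit Nil)
    (pair (Lit (Cons (Num 0) Nil)) (Call 13 (pair (Lit Nil) acc)))].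

(** * Correctness and cost of the list functions *)

#[local] Arguments enc_ord : simpl never.
#[local] Arguments dsize : simpl never.
#[local] Arguments expn : simpl never.

Lemma dsize_cons a b : dsize (Cons a b) = (dsize a + dsize b).+1.
Proof. by []. Qed.

Lemma dsize_nil : dsize Nil = 1%N.
Proof. by []. Qed.

Lemma dsize_num0 : (dsize (Num 0) <= 2)%N.
Proof. exact: (dsize_nat 0). Qed.

Lemma dsize_num1 : (dsize (Num 1) <= 3)%N.
Proof. exact: (dsize_nat 1). Qed.

Lemma dsize_ord n (i : 'I_n) : (dsize (enc_ord i) <= n.+1)%N.
Proof. by apply: leq_trans (dsize_nat i) _; exact: ltn_ord. Qed.

Ltac steps S :=
  repeat lazymatch goal with
  | |- silent _ _ _ (Var _) _ _ => apply: silent_var; reflexivity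
  | |- silent _ _ _ (Lit _) _ _ => apply: silent_lit
  | |- silent _ _ _ (Op1 Car _) _ _ => apply: (silent_car (S := S))
  | |- silent _ _ _ (Op1 Cdr _) _ _ => apply: (silent_cdr (S := S))
  | |- silent _ _ _ (Op2 Pair _ _) _ _ =>
      apply: (silent_op2 (S := (2 * S)%N)); [ | | reflexivity | ]
  | |- is_true (dsize _ <= S)%N => rewrite ?enc_seq_cons ?dsize_cons ?dsize_nil; lia
  | |- is_true ((dsize _ + dsize _ + dsize _).+1 <= 2 * S)%N =>
      rewrite ?enc_seq_cons ?dsize_cons ?dsize_nil; lia
  end.

Lemma dsize_suffix (T : Type) (f : T -> data) s1 s2 s : s = s1 ++ s2 ->
  (dsize (enc_seq f s2) <= dsize (enc_seq f s))%N.
Proof.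
by move=> ->; elim: s1 => //= x s1 IH; rewrite enc_seq_cons dsize_cons; lia.
Qed.

Lemma foldr_cat_cons (T : Type) (s1 s2 : seq T) :
  foldr (fun v r => v :: r) s2 s1 = s1 ++ s2.
Proof. by elim: s1 => //= x s ->. Qed.

(** Starting from 1 keeps the value positive even if no entry is, as when the root is the only node.
    Skipping nonpositive entries discards the zero on the diagonal. *)
Definition least_positive (l : seq rat) : rat :=
  foldr (fun e r => if e <= 0 then r else if e <= r then e else r) 1 l.

Lemma dsize_least_positive l :
  (dsize (Num (least_positive l)) <= 3 + dsize (enc_seq Num l))%N.
Proof.
elim: l => [|e l IH]; first by apply: leq_trans dsize_num1 _.
rewrite enc_seq_cons dsize_cons /=.
by case: ifP => _; [lia | case: ifP => _; lia].
Qed.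

Definition singleton_code (k : nat) : data := Cons (Num k%:R) Nil.
Local Notation singletons := (enc_seq singleton_code).

Lemma dsize_singletons n (l : seq nat) : (size l <= n.+1)%N ->
  {in l, forall k, k <= n.+1}%N -> (dsize (singletons l) <= (2 * n.+1) * n.+3 + 1)%N.
Proof.
move=> sl bl; apply: leq_trans (dsize_enc_seq (b := n.+4.+1) _) _.
  by move=> k /bl kn; rewrite dsize_cons dsize_nil; have := dsize_nat k; lia.
rewrite leq_add2r; apply: leq_trans (leq_mul sl (leqnn _)) _; lia.
Qed.

Section Programs.
Variables (n : nat) (sub : behaviour) (init query : expr) (beta : rat) (S : nat).
Local Notation node := 'I_n.+1.
Local Notation nodes := (enc_seq (@enc_ord n.+1)).
Let p := table init query beta.
Local Notation silent := (silent sub p).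
(** Bounds the code of a list of at most [2 * n.+1] nodes, each of size at most [n.+2]. The factor 2
    leaves room for the crude size bound on [insert_after]. *)
Let L := ((2 * n.+1) * n.+3 + 1)%N.
Hypothesis leS : (8 * L + 50 <= S)%N.

Let leL : (n.+3 <= L)%N.
Proof. by rewrite /L; lia. Qed.

Lemma dsize_nodes (W : seq node) : (size W <= 2 * n.+1)%N -> (dsize (nodes W) <= L)%N.
Proof.
move=> le; apply: leq_trans (dsize_enc_seq (b := n.+2) _) _.
  by move=> i _; apply: dsize_ord.
by rewrite /L leq_add2r leq_mul2r le orbT.
Qed.

Lemma silent_same env a b (i j : node) Ta Tb :
  silent env a (enc_ord i) Ta -> silent env b (enc_ord j) Tb ->
  silent env (same a b) (enc_bool (i == j)) (2 * (Ta + Tb) + 3 * S).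
Proof.
move=> ha hb.
have di := dsize_ord i; have dj := dsize_ord j.
apply: silent_le.
  apply: (silent_if_bool (b := (i <= j)%N) (T2 := (Ta + Tb + S)%N)).
    apply: (silent_op2 ha hb (S := S)); first by rewrite /= ler_nat.
    by have := dsize_bool (i <= j)%N; lia.
  have -> : (i == j) = (i <= j <= i)%N.
    by apply/eqP/idP => [->|/anti_leq /val_inj //]; rewrite leqnn.
  case: (i <= j)%N => /=.
    rewrite [(Ta + Tb)%N]addnC.
    apply: (silent_op2 hb ha (S := S)); first by rewrite /= ler_nat.
    by have := dsize_bool (j <= i)%N; lia.
  by apply: silent_le; [exact: silent_lit | rewrite dsize_nil; lia].
lia.
Qed.

Let S_pow : [/\ (S <= S ^ 2)%N, (S ^ 2 <= S ^ 3)%N & (S ^ 3 <= S ^ 4)%N].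
Proof. by rewrite -{1}[S]expn1 !leq_exp2l //; lia. Qed.

Lemma silent_mem v (W : seq node) : (size W <= 2 * n.+1)%N ->
  silent [:: Cons (enc_ord v) (nodes W)] (nth (Lit Nil) p 2)
    (enc_bool (v \in W)) (100 * S ^ 2).
Proof.
move=> sW; have dv := dsize_ord v; have dW := dsize_nodes sW.
have -> : (v \in W) = foldr (fun e r => (e == v) || r) false W.
  by elim: W {sW dW} => //= x W IH; rewrite in_cons eq_sym IH.
have d1 := dsize_num1.
apply: (silent_foldr_pow (encA := enc_bool) (base := Lit Nil)
   (step := If (same elt ctx) true_ acc)).
- by [].
- by rewrite dsize_cons; lia.
- exact: silent_lit.
- move=> s1 e s2 EW; have s2W : (size s2 <= 2 * n.+1)%N.
    by move: sW; rewrite EW size_cat /=; lia.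
  have ds2 := dsize_nodes s2W; have de := dsize_ord e.
  rewrite enc_seq_cons.
  apply: silent_if_bool.
    by apply: silent_same; steps S.
  rewrite [foldr _ _ (_ :: _)]/=; case: (e == v) => /=.
    apply: silent_lit.
  apply: silent_le; first exact: silent_var.
  exact: dsize_gt0.
- by rewrite expn1 dsize_nil; lia.
Qed.

Lemma silent_insert u v (W : seq node) : (size W <= n.+1)%N ->
  silent [:: Cons (Cons (enc_ord u) (enc_ord v)) (nodes W)] (nth (Lit Nil) p 3)
    (nodes (insert_after u v W)) (200 * S ^ 2).
Proof.
move=> sW; have du := dsize_ord u; have dv := dsize_ord v.
have sW' : (size W <= 2 * n.+1)%N by lia.
have dW := dsize_nodes sW'.
apply: (silent_foldr_pow (encA := nodes) (Ts := (100 * S)%N)).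
- by [].
- by rewrite !dsize_cons; lia.
- exact: silent_lit.
- move=> s1 e s2 EW; have s2W : (size s2 < n.+1)%N.
    by move: sW; rewrite EW size_cat /=; lia.
  have s2W' : (size s2 <= 2 * n.+1)%N by lia.
  have ds2 := dsize_nodes s2W'; have de := dsize_ord e.
  have : (dsize (nodes (insert_after u v (e :: s2))) <= L)%N.
    by apply: dsize_nodes; apply: leq_trans (size_insert_after _ _ _) _ => /=; lia.
  have : (dsize (nodes (insert_after u v s2)) <= L)%N.
    by apply: dsize_nodes; apply: leq_trans (size_insert_after _ _ _) _ => /=; lia.
  rewrite /insert_after [foldr _ _ (_ :: _)]/=.
  move: (foldr _ _ s2) => r dr dr'; rewrite !enc_seq_cons.
  apply: silent_le; first apply: (silent_if_bool (T2 := (30 * S)%N)).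
  + by apply: silent_same; steps S.
  + by case: (e == u) dr'; rewrite ?enc_seq_cons ?dsize_cons => dr';
      apply: silent_le; [steps S | lia | steps S | lia].
  + lia.
- by rewrite expn1 dsize_nil; lia.
Qed.

Lemma silent_pass (E : seq (node * node)) (W : seq node) : uniq W ->
  (8 * L + 50 + dsize (enc_edges E) <= S)%N ->
  silent [:: Cons (nodes W) (enc_edges E)] (nth (Lit Nil) p 4)
    (nodes (pass E W)) (600 * S ^ 3).
Proof.
move=> uW lE; have [S2 S3 S4] := S_pow.
have sW := size_uniq_node uW.
have dW := dsize_nodes (leq_trans sW (leq_pmull _ (ltn0Sn 1))).
apply: (silent_foldr_pow (encA := nodes) (Ts := (500 * S ^ 2)%N)).
- by [].
- by move: lE; rewrite !dsize_cons /enc_edges; lia.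
- steps S; rewrite -/nodes; lia.
- move=> s1 e s2 EE.
  have : (dsize (enc_edges (e :: s2)) <= dsize (enc_edges E))%N.
    exact: dsize_suffix EE.
  rewrite {1}/enc_edges [foldr _ _ (_ :: _)]/= enc_seq_cons !dsize_cons.
  set r := foldr _ _ s2 => dE.
  (* Without duplicates the partial tour has at most [n.+1] entries, which keeps the inner folds
     within [S]. *)
  have ur : uniq r by exact: uniq_pass.
  have sr := size_uniq_node ur; have sr' : (size r <= 2 * n.+1)%N by lia.
  have dr := dsize_nodes sr'.
  have d1 := dsize_ord e.1; have d2 := dsize_ord e.2.
  have m1 := silent_mem e.1 sr'; have m2 := silent_mem e.2 sr'.
  have i1 := silent_insert e.1 e.2 sr; have i2 := silent_insert e.2 e.1 sr.
  rewrite /grow; apply: silent_le.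
    apply: (silent_if_bool (b := e.1 \in r) (T2 := (350 * S ^ 2)%N)).
    + by apply: (silent_call _ m1); steps S.
    + case: (e.1 \in r).
      * apply: silent_le.
          apply: (silent_if_bool (b := e.2 \in r) (T2 := (240 * S ^ 2)%N)).
            by apply: (silent_call _ m2); steps S.
          case: (e.2 \in r); first by apply: silent_le; [steps S | lia].
          by apply: silent_le; first (by apply: (silent_call _ i1); steps S); lia.
        by lia.
      * apply: silent_le.
          apply: (silent_if_bool (b := e.2 \in r) (T2 := (240 * S ^ 2)%N)).
            by apply: (silent_call _ m2); steps S.
          case: (e.2 \in r); last by apply: silent_le; [steps S | lia].
          by apply: silent_le; first (by apply: (silent_call _ i2); steps S); lia.
        by lia.
  lia.
- lia.
Qed.

(** The rows of the distance matrix serve as a counter: there is one row per node, and one pass per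
    node is wanted. *)
Lemma silent_tour (E : seq (node * node)) (d : 'M[rat]_n.+1) :
  (8 * L + 50 + dsize (enc_edges E) + dsize (enc_mx d) <= S)%N ->
  silent [:: Cons (enc_edges E) (enc_mx d)] (nth (Lit Nil) p 5)
    (nodes (tour E)) (700 * S ^ 4).
Proof.
move=> lE; have [S2 S3 S4] := S_pow; have d0 := dsize_num0.
rewrite /enc_mx /enc_fun in lE *.
apply: (silent_foldr_pow (encA := nodes) (Ts := (650 * S ^ 3)%N)).
- by [].
- by rewrite !dsize_cons; lia.
- exact: silent_lit.
- move=> s1 e s2 EE.
  have := dsize_suffix (fun i => enc_seq (fun j => Num (d i j)) (enum 'I_n.+1)) EE.
  rewrite [foldr _ _ (_ :: _)]/= enc_seq_cons !dsize_cons.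
  set r := foldr _ _ s2 => dE.
  have ur : uniq r by rewrite /r; elim: (s2) => // x s IH; exact: uniq_pass.
  have sr := size_uniq_node ur; have sr' : (size r <= 2 * n.+1)%N by lia.
  have dr := dsize_nodes sr'.
  apply: silent_le.
    apply: silent_call; last by apply: (silent_pass (E := E) ur); lia.
    by steps S.
  lia.
- by rewrite dsize_cons dsize_nil; lia.
Qed.

Lemma silent_filter (P W : seq node) : uniq P -> uniq W ->
  silent [:: Cons (nodes P) (nodes W)] (nth (Lit Nil) p 6)
    (nodes [seq v <- W | v \notin P]) (200 * S ^ 3).
Proof.
move=> uP uW; have [S2 S3 S4] := S_pow.
have sW := leq_trans (size_uniq_node uW) (leq_pmull _ (ltn0Sn 1)).
have sP := leq_trans (size_uniq_node uP) (leq_pmull _ (ltn0Sn 1)).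
have dW := dsize_nodes sW; have dP := dsize_nodes sP.
have -> : [seq v <- W | v \notin P] =
    foldr (fun v r => if v \in P then r else v :: r) [::] W.
  by elim: (W) => //= x s ->; case: (x \in P).
apply: (silent_foldr_pow (encA := nodes) (Ts := (150 * S ^ 2)%N)).
- by [].
- by rewrite !dsize_cons; lia.
- exact: silent_lit.
- move=> s1 e s2 EW; have s2W : (size s2 <= 2 * n.+1)%N.
    by move: sW; rewrite EW size_cat /=; lia.
  have ds2 := dsize_nodes s2W; have de := dsize_ord e.
  rewrite [foldr _ _ (_ :: _)]/= enc_seq_cons; set r := foldr _ _ s2.
  have dr : (dsize (nodes r) <= L)%N.
    apply: dsize_nodes; apply: leq_trans s2W; rewrite /r.
    by elim: (s2) => //= x s IH; case: ifP => /= _; lia.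
  have m := silent_mem e sP.
  apply: silent_le; first apply: (silent_if_bool (T2 := (30 * S)%N)).
  + by apply: (silent_call _ m); steps S.
  + by case: (e \in P); rewrite ?enc_seq_cons; apply: silent_le; [steps S | lia | steps S | lia].
  + lia.
- by rewrite dsize_nil; lia.
Qed.

Lemma silent_cat (W P : seq node) : uniq (P ++ W) ->
  silent [:: Cons (nodes W) (nodes P)] (nth (Lit Nil) p 7)
    (nodes (P ++ W)) (100 * S ^ 2).
Proof.
move=> uPW; have [S2 S3 S4] := S_pow.
have sPW := leq_trans (size_uniq_node uPW) (leq_pmull _ (ltn0Sn 1)).
rewrite size_cat in sPW.
have sW : (size W <= 2 * n.+1)%N by lia.
have sP : (size P <= 2 * n.+1)%N by lia.
have dW := dsize_nodes sW; have dP := dsize_nodes sP.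
have -> : P ++ W = foldr (fun v r => v :: r) W P by rewrite foldr_cat_cons.
apply: (silent_foldr_pow (encA := nodes) (Ts := (30 * S)%N)).
- by [].
- by rewrite !dsize_cons; lia.
- by steps S.
- move=> s1 e s2 EP; have s2P : (size (s2 ++ W) <= 2 * n.+1)%N.
    by move: sPW; rewrite EP !size_cat /=; lia.
  have s2P' : (size s2 <= 2 * n.+1)%N by move: s2P; rewrite size_cat; lia.
  have de := dsize_ord e; have ds2 := dsize_nodes s2P'.
  have dr := dsize_nodes s2P.
  rewrite [foldr _ _ (_ :: _)]/= !enc_seq_cons foldr_cat_cons.
  by apply: silent_le; [steps S | lia].
- by rewrite expn1; lia.
Qed.

Lemma silent_hit (P g : seq node) : uniq P -> (size g <= n.+1)%N ->
  silent [:: Cons (nodes P) (nodes g)] (nth (Lit Nil) p 8)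
    (enc_bool (has (mem P) g)) (200 * S ^ 3).
Proof.
move=> uP sg; have [S2 S3 S4] := S_pow.
have sP := leq_trans (size_uniq_node uP) (leq_pmull _ (ltn0Sn 1)).
have sg' := leq_trans sg (leq_pmull _ (ltn0Sn 1)).
have dg := dsize_nodes sg'; have dP := dsize_nodes sP; have d1 := dsize_num1.
have -> : has (mem P) g = foldr (fun v r => (v \in P) || r) false g by [].
apply: (silent_foldr_pow (encA := enc_bool) (Ts := (150 * S ^ 2)%N)).
- by [].
- by rewrite !dsize_cons; lia.
- exact: silent_lit.
- move=> s1 e s2 EW; have s2W : (size s2 <= 2 * n.+1)%N.
    by move: sg'; rewrite EW size_cat /=; lia.
  have ds2 := dsize_nodes s2W; have de := dsize_ord e.
  rewrite [foldr _ _ (_ :: _)]/= enc_seq_cons.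
  have m := silent_mem e sP.
  apply: silent_le; first apply: (silent_if_bool (T2 := (30 * S)%N)).
  + by apply: (silent_call _ m); steps S.
  + by case: (e \in P); apply: silent_le; [steps S | lia | steps S | lia].
  + lia.
- by rewrite dsize_nil; lia.
Qed.

(** * Functions of the list of groups *)

Section Groups.
Variable gs : seq (seq node).
Hypothesis size_gs : {in gs, forall g, (size g <= n.+1)%N}.
Hypothesis leG : (8 * L + 50 + 2 * (size gs * (L + 10)) <= S)%N.
Local Notation groups := (enc_seq (enc_seq (@enc_ord n.+1))).

Definition weight (P g : seq node) : rat := (~~ has (mem P) g)%:R.

Lemma dsize_groups : (dsize (groups gs) <= size gs * L.+1 + 1)%N.
Proof.
apply: dsize_enc_seq => g gg; apply: dsize_nodes.
by apply: leq_trans (size_gs gg) _; exact: leq_pmull.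
Qed.

Lemma dsize_items P : (dsize (enc_seq (fun g => Cons (nodes g) (Num (weight P g))) gs) <=
  size gs * (L + 3).+2 + 1)%N.
Proof.
apply: dsize_enc_seq => g gg; rewrite dsize_cons ltnS leq_add //.
  by apply: dsize_nodes; apply: leq_trans (size_gs gg) _; exact: leq_pmull.
by rewrite /weight; apply: leq_trans (dsize_nat _) _; case: (has _ _).
Qed.

Lemma dsize_weights P : (dsize (enc_seq (fun g => Num (weight P g)) gs) <=
  size gs * 4 + 1)%N.
Proof.
apply: dsize_enc_seq => g gg.
by rewrite /weight; apply: leq_trans (dsize_nat _) _; case: (has _ _).
Qed.

Lemma silent_left (P : seq node) : uniq P ->
  silent [:: Cons (nodes P) (groups gs)] (nth (Lit Nil) p 9)
    (enc_bool (has (fun g => ~~ has (mem P) g) gs)) (300 * S ^ 4).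
Proof.
move=> uP; have [S2 S3 S4] := S_pow.
have sP := leq_trans (size_uniq_node uP) (leq_pmull _ (ltn0Sn 1)).
have dP := dsize_nodes sP; have d1 := dsize_num1; have dG := dsize_groups.
have -> : has (fun g => ~~ has (mem P) g) gs =
    foldr (fun g r => if has (mem P) g then r else true) false gs.
  by elim: (gs) => //= g s ->; case: (has _ g).
apply: (silent_foldr_pow (encA := enc_bool) (Ts := (250 * S ^ 3)%N)).
- by [].
- by rewrite !dsize_cons; lia.
- exact: silent_lit.
- move=> s1 e s2 EW; have sg : (size e <= n.+1)%N.
    by apply: size_gs; rewrite EW mem_cat mem_head orbT.
  have := dsize_suffix (enc_seq (@enc_ord n.+1)) EW.
  have dr := dsize_bool.
  rewrite [foldr _ _ (_ :: _)]/= enc_seq_cons dsize_cons => dE.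
  have m := silent_hit uP sg.
  apply: silent_le; first apply: (silent_if_bool (T2 := (30 * S)%N)).
  + by apply: (silent_call _ m); steps S.
  + by case: (has _ e); apply: silent_le; [steps S | lia | steps S | lia].
  + lia.
- by rewrite dsize_nil; lia.
Qed.

Lemma silent_weight env eP eg (P g : seq node) TP Tg : uniq P -> (size g <= n.+1)%N ->
  silent env eP (nodes P) TP -> silent env eg (nodes g) Tg ->
  silent env (If (Call 8 (pair eP eg)) (Lit (Num 0)) true_)
    (Num (weight P g)) (TP + Tg + 210 * S ^ 3).
Proof.
move=> uP sg hP hg; have [S2 S3 S4] := S_pow.
have sP := leq_trans (size_uniq_node uP) (leq_pmull _ (ltn0Sn 1)).
have sg' := leq_trans sg (leq_pmull _ (ltn0Sn 1)).
have dg := dsize_nodes sg'; have dP := dsize_nodes sP.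
have d1 := dsize_num1; have d0 := dsize_num0.
have m := silent_hit uP sg.
apply: silent_le; first apply: (silent_if_bool (T2 := 3)).
- apply: (silent_call _ m); apply: (silent_op2 hP hg (S := S)) => //.
  by rewrite /= !dsize_cons; lia.
- by rewrite /weight; case: (has _ _); apply: silent_le; [steps S | lia | steps S | lia].
- lia.
Qed.

Lemma silent_items (P : seq node) : uniq P ->
  silent [:: Cons (nodes P) (groups gs)] (nth (Lit Nil) p 10)
    (enc_seq (fun g => Cons (nodes g) (Num (weight P g))) gs) (300 * S ^ 4).
Proof.
move=> uP; have [S2 S3 S4] := S_pow.
have sP := leq_trans (size_uniq_node uP) (leq_pmull _ (ltn0Sn 1)).
have dP := dsize_nodes sP; have dG := dsize_groups; have dI := dsize_items P.
apply: (silent_foldr_pow (encA := id) (Ts := (250 * S ^ 3)%N)).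
- by [].
- by rewrite !dsize_cons; lia.
- exact: silent_lit.
- move=> s1 e s2 EW; have sg : (size e <= n.+1)%N.
    by apply: size_gs; rewrite EW mem_cat mem_head orbT.
  have := dsize_suffix (enc_seq (@enc_ord n.+1)) EW.
  have := dsize_suffix (fun g => Cons (nodes g) (Num (weight P g))) EW.
  rewrite -/(enc_seq (fun g => Cons (nodes g) (Num (weight P g))) (e :: s2)).
  rewrite -/(enc_seq (fun g => Cons (nodes g) (Num (weight P g))) s2).
  rewrite !enc_seq_cons !dsize_cons => dI' dE.
  apply: silent_le; first apply: (silent_op2 (S := S)).
  + apply: (silent_op2 (S := S)); [steps S | | by [] |].
      by apply: (silent_weight uP sg); steps S.
    by rewrite dsize_cons; lia.
  + by steps S.
  + by [].
  + by rewrite /= !dsize_cons; lia.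
  + lia.
- by rewrite dsize_nil; lia.
Qed.

Lemma silent_weights (P : seq node) : uniq P ->
  silent [:: Cons (nodes P) (groups gs)] (nth (Lit Nil) p 11)
    (enc_seq (fun g => Num (weight P g)) gs) (300 * S ^ 4).
Proof.
move=> uP; have [S2 S3 S4] := S_pow.
have sP := leq_trans (size_uniq_node uP) (leq_pmull _ (ltn0Sn 1)).
have dP := dsize_nodes sP; have dG := dsize_groups; have dI := dsize_weights P.
apply: (silent_foldr_pow (encA := id) (Ts := (250 * S ^ 3)%N)).
- by [].
- by rewrite !dsize_cons; lia.
- exact: silent_lit.
- move=> s1 e s2 EW; have sg : (size e <= n.+1)%N.
    by apply: size_gs; rewrite EW mem_cat mem_head orbT.
  have := dsize_suffix (enc_seq (@enc_ord n.+1)) EW.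
  have := dsize_suffix (fun g => Num (weight P g)) EW.
  rewrite -/(enc_seq (fun g => Num (weight P g)) (e :: s2)).
  rewrite -/(enc_seq (fun g => Num (weight P g)) s2).
  rewrite !enc_seq_cons !dsize_cons => dI' dE.
  apply: silent_le; first apply: (silent_op2 (S := S)).
  + by apply: (silent_weight uP sg); steps S.
  + by steps S.
  + by [].
  + by rewrite /= !dsize_cons; lia.
  + lia.
- by rewrite dsize_nil; lia.
Qed.

End Groups.

Lemma silent_least_positive (l : seq rat) :
  (8 * L + 50 + 2 * dsize (enc_seq Num l) <= S)%N ->
  silent [:: Cons Nil (enc_seq Num l)] (nth (Lit Nil) p 12)
    (Num (least_positive l)) (100 * S ^ 2).
Proof.
move=> leS'; have d1 := dsize_num1; have d0 := dsize_num0; have db := dsize_bool.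
apply: (silent_foldr_pow (encA := Num) (Ts := (70 * S)%N)).
- by [].
- by rewrite dsize_cons dsize_nil; lia.
- by steps S.
- move=> s1 e s2 EE.
  have := dsize_suffix Num EE; have := dsize_least_positive s2.
  rewrite /least_positive [foldr _ _ (_ :: _)]/= enc_seq_cons dsize_cons.
  set r := foldr _ _ s2 => dr dE.
  apply: silent_le; first apply: (silent_if_bool (b := e <= 0) (T2 := (50 * S)%N)).
  + apply: (silent_op2 (v2 := Num 0) (S := S)); [steps S | steps S | by [] |].
    by have := db (e <= 0); lia.
  + case: (e <= 0); first by apply: silent_le; [steps S | lia].
    apply: silent_le.
      apply: (silent_if_bool (b := e <= r) (T2 := (10 * S)%N)).
        apply: (silent_op2 (v2 := Num r) (S := S)); [steps S | steps S | by [] |].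
        by have := db (e <= r); lia.
      by case: (e <= r); apply: silent_le; [steps S | lia | steps S | lia].
    lia.
  + lia.
- by rewrite expn1; lia.
Qed.

Lemma silent_succ (l : seq nat) : (size l <= n.+1)%N -> {in l, forall k, k <= n}%N ->
  silent [:: Cons Nil (singletons l)] (nth (Lit Nil) p 13)
    (singletons (map succn l)) (100 * S ^ 2).
Proof.
move=> sl bl; have d1 := dsize_num1.
have -> : map succn l = foldr (fun k r => k.+1 :: r) [::] l.
  by elim: (l) => //= k s ->.
have dl : (dsize (singletons l) <= L)%N.
  by apply: dsize_singletons => // k /bl; exact: leqW.
apply: (silent_foldr_pow (encA := singletons) (Ts := (70 * S)%N)).
- by [].
- by rewrite dsize_cons dsize_nil; lia.
- exact: silent_lit.
- move=> s1 e s2 EE; have := dsize_suffix singleton_code EE.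
  have -> : foldr (fun k r => k.+1 :: r) [::] s2 = map succn s2.
    by elim: (s2) => //= k s ->.
  have -> : foldr (fun k r => k.+1 :: r) [::] (e :: s2) = e.+1 :: map succn s2.
    by rewrite /=; congr (_ :: _); elim: (s2) => //= k s ->.
  have ds : (dsize (singletons (e.+1 :: map succn s2)) <= L)%N.
    rewrite -[e.+1 :: _]/(map succn (e :: s2)); apply: dsize_singletons.
      by rewrite size_map; move: sl; rewrite EE size_cat; lia.
    move=> k /mapP[j js ->]; rewrite ltnS; apply: bl.
    by rewrite EE mem_cat js orbT.
  move: ds; rewrite !enc_seq_cons !dsize_cons !dsize_nil => ds dE.
  have de1 := dsize_nat e.+1.
  apply: silent_le; first apply: (silent_op2 (S := S)).
  + apply: (silent_op2 (v1 := Num e.+1%:R) (v2 := Nil) (S := S)).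
    * apply: (silent_op2 (v1 := Num 1) (v2 := Num e%:R) (S := (2 * S)%N)).
      - by steps S.
      - by steps S.
      - by rewrite /= -mulrS.
      - have de := dsize_nat e; lia.
    * by steps S.
    * by [].
    * by rewrite dsize_cons dsize_nil; lia.
  + by steps S.
  + by [].
  + by rewrite /= !dsize_cons ?dsize_nil; lia.
  + rewrite dsize_nil; lia.
- by rewrite expn1 dsize_nil; lia.
Qed.

(** Only the length of [l] matters: each step increments the entries found so far and prepends 0.
    Applied to the rows of the matrix, it builds the singleton groups, which an ML input does not
    contain. *)
Lemma silent_iota (T : Type) (encT : T -> data) (l : seq T) : (size l = n.+1)%N ->
  (8 * L + 50 + 2 * dsize (enc_seq encT l) <= S)%N ->
  silent [:: Cons Nil (enc_seq encT l)] (nth (Lit Nil) p 14)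
    (singletons (iota 0 n.+1)) (200 * S ^ 3).
Proof.
move=> sl leS'; have d0 := dsize_num0; have [S2 S3 S4] := S_pow.
have iotaE (s : seq T) : foldr (fun _ r => 0%N :: map succn r) [::] s = iota 0 (size s).
  by elim: s => //= _ s ->; rewrite -[1%N]/(1 + 0)%N iotaDl.
rewrite -sl -iotaE.
apply: (silent_foldr_pow (encA := singletons) (Ts := (150 * S ^ 2)%N)).
- by [].
- by rewrite dsize_cons dsize_nil; lia.
- exact: silent_lit.
- move=> s1 e s2 EE; have := dsize_suffix encT EE.
  have sz : (size s2 <= n)%N by move: sl; rewrite EE size_cat /=; lia.
  rewrite [foldr _ _ (_ :: _)]/= iotaE.
  have h1 : (dsize (singletons (iota 0 (size s2))) <= L)%N.
    apply: dsize_singletons; first by rewrite size_iota leqW.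
    by move=> k; rewrite mem_iota; lia.
  have h2 : (dsize (singletons (map succn (iota 0 (size s2)))) <= L)%N.
    apply: dsize_singletons; first by rewrite size_map size_iota leqW.
    by move=> k /mapP[j + ->]; rewrite mem_iota; lia.
  have m : silent [:: Cons Nil (singletons (iota 0 (size s2)))] (nth (Lit Nil) p 13)
      (singletons (map succn (iota 0 (size s2)))) (100 * S ^ 2).
    apply: silent_succ; first by rewrite size_iota leqW.
    by move=> k; rewrite mem_iota; lia.
  rewrite !enc_seq_cons !dsize_cons => dE.
  apply: silent_le; first apply: (silent_op2 (S := S)).
  + by steps S.
  + by apply: (silent_call _ m); steps S.
  + by [].
  + by rewrite /= -[singleton_code 0]/(Cons (Num 0) Nil) !dsize_cons dsize_nil; lia.
  + by rewrite !dsize_cons !dsize_nil; lia.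
- by rewrite dsize_nil; lia.
Qed.

End Programs.

(** * Tours of trees *)

Section Walks.
Variables (n : nat) (d : 'M[rat]_n.+1).
Hypothesis dP : is_metric d.
Local Notation node := 'I_n.+1.
Local Notation walk_len := (walk_len d).
Implicit Types (u v x y : node) (p q s W : seq node) (E : seq (node * node)).

Let d_ge0 u v : 0 <= d u v. Proof. by case: dP. Qed.
Let dC u v : d u v = d v u. Proof. by case: dP. Qed.
Let d_triangle u v x : d u x <= d u v + d v x. Proof. by case: dP. Qed.
Let d_refl u : d u u = 0. Proof. by case: dP => _ h _ _; apply/eqP; rewrite h. Qed.

Lemma walk_len_ge0 u p : 0 <= walk_len u p.
Proof. by elim: p u => //= v p IH u; rewrite addr_ge0. Qed.

Lemma walk_len_cat u p q :
  walk_len u (p ++ q) = walk_len u p + walk_len (last u p) q.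
Proof. by elim: p u => /= [|v p IH] u; rewrite ?add0r // IH addrA. Qed.

Lemma le_walk_len u p : d u (last u p) <= walk_len u p.
Proof.
elim: p u => /= [|v p IH] u; first by rewrite d_refl.
by apply: le_trans (d_triangle u v _) _; rewrite lerD2l.
Qed.

(** The final [y] guarantees a first step, to which the triangle inequality applies. *)
Lemma walk_len_detour u v s y :
  walk_len u (s ++ [:: y]) <= d u v + walk_len v (s ++ [:: y]).
Proof.
by case: s => [|x s] /=; rewrite ?addr0 // addrA lerD2r.
Qed.

Lemma walk_len_filter a u s y :
  walk_len u ([seq x <- s | a x] ++ [:: y]) <= walk_len u (s ++ [:: y]).
Proof.
elim: s u => //= x s IH u; case: (a x) => /=; first by rewrite lerD2l.
by apply: le_trans (walk_len_detour _ x _ _) _; rewrite lerD2l.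
Qed.

(** Going from [u] to [v] and back costs [2 * d u v], and leaving [v] directly for the next stop is
    no longer than returning to [u] first. If [u] is the last node, the next stop is the closing
    point [y]. *)
Lemma walk_len_insert u v x s y : uniq (x :: s) -> u \in x :: s ->
  walk_len x (behead (insert_after u v (x :: s)) ++ [:: y]) <=
    walk_len x (s ++ [:: y]) + 2 * d u v.
Proof.
elim: s x => [|z s IH] x.
  move=> _; rewrite inE => /eqP ->; rewrite /= eqxx /= !addr0.
  have := d_triangle v x y; rewrite (dC v x); lra.
move=> /andP[xzs uzs]; rewrite in_cons.
have [ux _|ux uin] := eqVneq u x.
  have -> : insert_after u v [:: x, z & s] = [:: x, v, z & s].
    rewrite -[LHS]/(if x == u then [:: x, v & insert_after u v (z :: s)]
      else x :: insert_after u v (z :: s)).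
    by rewrite ux eqxx insert_after_notin.
  have := walk_len_detour v x (z :: s) y; rewrite (dC v x) ux.
  by rewrite /=; lra.
have {}uin : u \in z :: s by move: uin.
have := IH z uzs uin.
have -> : insert_after u v [:: x, z & s] = x :: insert_after u v (z :: s).
  by rewrite /= eq_sym (negPf ux).
have [r ->] : exists r, insert_after u v (z :: s) = z :: r.
  by rewrite /=; case: ifP => _; eexists.
by rewrite /= => h; rewrite -addrA lerD2l.
Qed.

Definition closed_len W : rat := walk_len ord0 (behead W ++ [:: ord0]).

Section Tour.
Variable E : seq (node * node).

Let inside W (e : node * node) := (e.1 \in W) && (e.2 \in W).

(** The length is charged to edges with both ends on the tour. An edge used for an insertion becomes
    such an edge at that moment and remains one, so it is charged once over all passes. *)
Let tour_inv W := [/\ uniq W, exists s, W = ord0 :: s &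
  closed_len W <= 2 * \sum_(e <- E | inside W e) d e.1 e.2].

Lemma closed_len_insert W u v : uniq W -> (exists s, W = ord0 :: s) -> u \in W ->
  (exists s, insert_after u v W = ord0 :: s) /\
  closed_len (insert_after u v W) <= closed_len W + 2 * d u v.
Proof.
move=> uW [s EW] uin; rewrite EW in uW uin *; split.
  by rewrite /=; case: ifP => _; eexists.
exact: walk_len_insert.
Qed.

Lemma sum_inside W W' e : e \in E -> {subset W <= W'} -> ~~ inside W e ->
  inside W' e ->
  \sum_(f <- E | inside W f) d f.1 f.2 + d e.1 e.2 <=
    \sum_(f <- E | inside W' f) d f.1 f.2.
Proof.
move=> eE sub nW iW'; rewrite !(big_rem e eE) /= (negPf nW) iW' add0r [leLHS]addrC lerD2l.
rewrite [leLHS]big_mkcond [leRHS]big_mkcond /=; apply: ler_sum => f _.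
rewrite /inside; have [f1 /=|_] := boolP (f.1 \in W); last by case: ifP.
by have [f2 /=|_] := boolP (f.2 \in W); rewrite ?(sub _ f1) ?(sub _ f2) //; case: ifP.
Qed.

Lemma tour_inv_grow e W : e \in E -> tour_inv W -> tour_inv (grow e W).
Proof.
move=> eE [uW hW lW]; split; first exact: uniq_grow.
- rewrite /grow; have [e1|_] := boolP (e.1 \in W); have [e2|_] := boolP (e.2 \in W) => //.
    by case: (closed_len_insert e.2 uW hW e1).
  by case: (closed_len_insert e.1 uW hW e2).
rewrite /grow; have [e1|e1] := boolP (e.1 \in W); have [e2|e2] := boolP (e.2 \in W) => //.
  have [_ h] := closed_len_insert e.2 uW hW e1; apply: le_trans h _.
  have : \sum_(f <- E | inside W f) d f.1 f.2 + d e.1 e.2 <=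
      \sum_(f <- E | inside (insert_after e.1 e.2 W) f) d f.1 f.2.
    apply: sum_inside => //.
    - by move=> x xW; rewrite mem_insert_after // xW orbT.
    - by rewrite /inside (negPf e2) andbF.
    - by rewrite /inside !mem_insert_after // e1 eqxx orbT.
  by move: lW; lra.
have [_ h] := closed_len_insert e.1 uW hW e2; apply: le_trans h _.
have : \sum_(f <- E | inside W f) d f.1 f.2 + d e.1 e.2 <=
    \sum_(f <- E | inside (insert_after e.2 e.1 W) f) d f.1 f.2.
  apply: sum_inside => //.
  - by move=> x xW; rewrite mem_insert_after // xW orbT.
  - by rewrite /inside (negPf e1).
  - by rewrite /inside !mem_insert_after // e2 eqxx orbT.
by move: lW; rewrite (dC e.2 e.1); lra.
Qed.

Lemma tour_inv_pass W : tour_inv W -> tour_inv (pass E W).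
Proof.
move=> iW; rewrite /pass.
have: {subset E <= E} by [].
elim: {1 3}E => //= e s IH sub; apply: tour_inv_grow.
  by apply: sub; rewrite mem_head.
by apply: IH => f fs; apply: sub; rewrite in_cons fs orbT.
Qed.

Lemma tour_inv_tour : tour_inv (tour E).
Proof.
rewrite /tour; elim: (enum _) => [|i s IH]; last exact: tour_inv_pass.
split; [by [] | by exists [::] | rewrite /closed_len /= d_refl addr0].
by rewrite mulr_ge0 ?ler0n // sumr_ge0.
Qed.

Lemma closed_len_tour : closed_len (tour E) <= 2 * tree_len d E.
Proof.
case: tour_inv_tour => _ _ h; apply: le_trans h _.
rewrite ler_pM2l // /tree_len [leLHS]big_mkcond /=.
by apply: ler_sum => e _; case: ifP.
Qed.

Lemma sub_grow e W : {subset W <= grow e W}.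
Proof.
move=> x xW; rewrite /grow; have [e1|e1] := boolP (e.1 \in W);
  have [e2|e2] := boolP (e.2 \in W) => //; by rewrite mem_insert_after // xW orbT.
Qed.

Lemma sub_pass (s : seq (node * node)) W : {subset W <= pass s W}.
Proof. by elim: s => //= e s IH x xW; apply/sub_grow/IH. Qed.

(** A pass only adds nodes: when the fold arrives at the edge joining [u] and [v], [u] is still
    present, so [v] is inserted unless it is there already. *)
Lemma pass_adj u v W : u \in W -> adj E u v -> v \in pass E W.
Proof.
move=> uW; rewrite /adj; elim: E => //= e s IH.
have uP : u \in pass s W by exact: sub_pass.
rewrite !in_cons => /orP[] /orP[/eqP Ee|h]; try by
  apply: sub_grow; apply: IH; rewrite h ?orbT.
  rewrite -Ee /grow /= uP; have [//|_] := boolP (v \in pass s W).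
  by rewrite mem_insert_after // eqxx.
rewrite -Ee /grow /= uP; have [//|_] := boolP (v \in pass s W).
by rewrite mem_insert_after // eqxx.
Qed.

(** Induction on the passes: after k of them, every node joined to the root by at most k edges is on
    the tour. A simple path has at most [n] edges. *)
Lemma tree_nodes_sub_tour : is_tree E -> {subset tree_nodes E <= tour E}.
Proof.
case=> _ _ conn _ v /conn /connectP[p0 path0 ->].
case: (shortenP path0) => p pp up _ {p0 path0}.
have : (size p <= size (enum 'I_n.+1))%N.
  by have := size_uniq_node up; rewrite size_enum_ord /= => /ltnW.
rewrite /tour; elim: (enum _) p pp {up} => [|i s IH] p pp.
  by rewrite leqn0 => /nilP ->; rewrite inE.
case/lastP: p pp => [_ _|p x]; first exact/sub_pass/(IH [::]).
rewrite rcons_path last_rcons size_rcons ltnS => /andP[pp a] sp.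
exact: pass_adj (IH p pp sp) a.
Qed.

End Tour.

(** Edges that differ as unordered pairs differ as ordered pairs. This keeps the answers of the
    subroutine small, whatever its running time. *)
Lemma size_tree_edges E : is_tree E -> (size E <= n.+1 * n.+1)%N.
Proof.
case=> _ u _ _; move/map_uniq/card_uniqP: u => <-.
by apply: leq_trans (max_card _) _; rewrite card_prod !card_ord.
Qed.

Lemma arrival_cat p q (a : pred node) : has a (ord0 :: p) ->
  arrival d (p ++ q) a = arrival d p a.
Proof.
move=> h; rewrite /arrival -cat_cons find_cat h takel_cat //.
by move: h; rewrite has_find ltnS.
Qed.

Lemma arrival_le p (a : pred node) : arrival d p a <= walk_len ord0 p.
Proof.
rewrite /arrival; move: (find _ _) => k.
by rewrite -{2}[p](cat_take_drop k) walk_len_cat lerDl walk_len_ge0.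
Qed.

Lemma arrival_ge0 p (a : pred node) : 0 <= arrival d p a.
Proof. exact: walk_len_ge0. Qed.

Lemma walk_len_closed p : walk_len ord0 p <= closed_len (ord0 :: p).
Proof. by rewrite /closed_len /= walk_len_cat lerDl walk_len_ge0. Qed.

(** The first node satisfying [a] is not the root, and a walk is at least as long as the distance
    between its ends. *)
Lemma arrival_ge_dist p (a : pred node) b : has a (ord0 :: p) -> ~~ a ord0 ->
  (forall v, v != ord0 -> b <= d ord0 v) -> b <= arrival d p a.
Proof.
move=> h n0 hb; rewrite /arrival.
have fs : (find a (ord0 :: p) < size (ord0 :: p))%N by rewrite -has_find.
set k := find a _ in fs *; have ak := nth_find ord0 h; rewrite -/k in ak.
apply: le_trans (le_walk_len _ _); apply: hb; apply: contraNneq n0.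
rewrite (last_nth ord0) size_takel; last by rewrite -ltnS.
by rewrite -[_ :: take _ _]/(take k.+1 (ord0 :: p)) nth_take // => <-.
Qed.

(** * Longest prefixes within a length budget, and optimal orienteering paths *)

Fixpoint within (B : rat) u p : seq node :=
  if p is v :: p' then if d u v <= B then v :: within (B - d u v) v p' else [::]
  else [::].

Lemma walk_len_within B u p : 0 <= B -> walk_len u (within B u p) <= B.
Proof.
elim: p B u => //= v p IH B u B0; case: ifP => //= h.
by rewrite -lerBrDl IH // subr_ge0.
Qed.

Lemma within_prefix B u p : within B u p = take (size (within B u p)) p.
Proof. by elim: p B u => //= v p IH B u; case: ifP => //= h; rewrite -IH. Qed.

Lemma within_take B u p k : walk_len u (take k p) <= B ->
  {subset take k p <= within B u p}.
Proof.
elim: p B u k => //= v p IH B u [|k] //= h x.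
have le : d u v <= B by apply: le_trans h; rewrite lerDl walk_len_ge0.
rewrite le !in_cons => /orP[->//|xp]; rewrite (IH (B - d u v) v k) ?orbT //.
by rewrite lerBrDl.
Qed.

Lemma within_feasible B p : 0 <= B -> simple_path p ->
  orient_feasible d B (within B ord0 p).
Proof.
move=> B0 up; split; last exact: walk_len_within.
rewrite /simple_path within_prefix; apply: subseq_uniq up.
by rewrite -[X in subseq X]/(take (size (within B ord0 p)).+1 (ord0 :: p)) take_subseq.
Qed.

(** [within] contains every prefix of length at most [B], in particular the one ending at the first
    node satisfying [a]. Latency in a fixed solution thus becomes coverage by a feasible
    orienteering path. *)
Lemma has_within B p (a : pred node) : has a (ord0 :: p) -> arrival d p a <= B ->
  has a (ord0 :: within B ord0 p).
Proof.
move=> h; rewrite /arrival => /within_take sub.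
have := nth_find ord0 h; have : (find a (ord0 :: p) < size (ord0 :: p))%N by rewrite -has_find.
set k := find a _ in sub *; move=> ks ak; apply/hasP; exists (nth ord0 (ord0 :: p) k) => //.
move: ks ak sub; case: k => [|k] /= ks ak sub; first by rewrite mem_head.
rewrite in_cons; apply/orP; right; apply: sub.
by rewrite -(nth_take ord0 (ltnSn k)) mem_nth // size_takel.
Qed.

(** Simple paths have bounded length, so the maximum ranges over a finite type. Since
    [tree_solution] compares with optimal paths only, existence is what gives the guarantee
    content. *)
Lemma orient_optimal_exists (reward : seq node -> rat) B : 0 <= B ->
  exists p, orient_optimal d B reward p.
Proof.
move=> B0; pose T := {bseq n.+1 of node}.
pose feas (p : T) := simple_path p && (walk_len ord0 p <= B).
have f0 : feas [bseq] by rewrite /feas /simple_path /= B0.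
case: (@Order.TotalTheory.arg_maxP _ _ _ [bseq] feas (fun p : T => reward (ord0 :: p)) f0).
move=> p /andP[sp lp] hmax; exists p; split; first by split.
move=> q [sq lq]; have szq : (size q <= n.+1)%N.
  by have := size_uniq_node sq; rewrite /= => /ltnW.
by apply: (hmax (Bseq szq)); rewrite /feas /= sq lq.
Qed.

End Walks.

(** * The phases *)

(** Here x is 1/N, r and r' count the unreached groups before and after a phase, and l the late
    ones. As (1 + x/2)(1 - x) = 1 - x/2 - x^2/2, adding r x/2 leaves at most r. *)
Lemma growth_absorbs (x r r' l : rat) : 0 <= r ->
  (1 + 2^-1 * x) * r' <= (1 + 2^-1 * x) * (r - x * r + x * l) ->
  r * (2^-1 * x) + (1 + 2^-1 * x) * r' <= r + (1 + 2^-1 * x) * x * l.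
Proof.
move=> r0 h; have : 0 <= x * x * r by rewrite mulr_ge0 // -expr2 sqr_ge0.
by lra.
Qed.

Section Phases.
Variables (n m : nat) (d : 'M[rat]_n.+1) (G : 'I_m -> {set 'I_n.+1}).
Variables (N Gam K : nat) (b0 : rat) (full : seq 'I_n.+1).
Hypothesis dP : is_metric d.
Hypothesis N_gt0 : (0 < N)%N.
Hypothesis b0_gt0 : 0 < b0.
Hypothesis b0_le : forall v, v != ord0 -> b0 <= d ord0 v.
Local Notation node := 'I_n.+1.
Local Notation walk_len := (walk_len d).

(* Chosen so that [growth * (1 - 1/N) <= 1 - 1/(2N)]: late groups apart, the
   number of unreached groups times the scale decreases geometrically. *)
Definition growth : rat := 1 + (2 * N%:R)^-1.
Definition scale t : rat := b0 * growth ^+ t.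

Hypothesis full_feasible : mgl_feasible G full.
Hypothesis full_short : walk_len ord0 full <= scale K.

Implicit Types (P p q o : seq node) (E : seq (node * node)) (t : nat).

Definition hit P j := has (mem (G j)) P.
Definition unhit P : nat := #|[set j | ~~ hit P j]|.
Definition hit_latency p : rat := \sum_(j | hit (ord0 :: p) j) arrival d p (mem (G j)).
Definition late o t : nat := #|[set j | scale t < arrival d o (mem (G j))]|.
Definition spent t : rat := \sum_(s < t) scale s.

(** The guarantee of the subroutine with integer factors and counts in place of rewards. It compares
    with every feasible path, so that a prefix of any solution can be substituted. *)
Definition good_tree P B E : Prop :=
  [/\ is_tree E, tree_len d E <= Gam%:R * B &
      forall q, orient_feasible d B q ->
        (#|[set j | ~~ hit P j && hit (ord0 :: q) j]| <=
         N * #|[set j | ~~ hit P j && hit (tree_nodes E) j]|)%N].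

Let N0 : (0 : rat) < N%:R. Proof. by rewrite ltr0n. Qed.

#[local] Arguments hit : simpl never.

Lemma growth_ge1 : 1 <= growth.
Proof. by rewrite /growth lerDl invr_ge0 mulr_ge0 // ltW. Qed.

Lemma growth_le : growth <= 3 / 2.
Proof.
have : (2 * N%:R)^-1 <= (2 : rat)^-1.
  by rewrite lef_pV2 ?posrE ?mulr_gt0 // ler_peMr // ler1n.
by rewrite /growth; lra.
Qed.

Lemma scale_gt0 t : 0 < scale t.
Proof. by rewrite mulr_gt0 // exprn_gt0 // (lt_le_trans ltr01) // growth_ge1. Qed.

Lemma scaleS t : scale t.+1 = growth * scale t.
Proof. by rewrite /scale exprS mulrCA. Qed.

Lemma scale_le s t : (s <= t)%N -> scale s <= scale t.
Proof. by move=> st; rewrite ler_pM2l // ler_weXn2l // growth_ge1. Qed.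

Lemma growthE : (2 * N%:R) * growth = 2 * N%:R + 1.
Proof. by rewrite /growth mulrDr mulr1 mulfV // mulf_neq0 // lt0r_neq0. Qed.

(** A geometric series with [growth - 1 = 1/(2N)]: the scales before t sum to at most 2N times scale
    t. The second bound follows from the first whenever a scale below [a] is added, since the next
    scale is then below [growth * a]. *)
Lemma sum_scales_below (a : rat) t : 0 <= a ->
  \sum_(s < t | scale s < a) scale s <= 2 * N%:R * (growth * a).
Proof.
move=> a0; have [] : \sum_(s < t | scale s < a) scale s <= 2 * N%:R * scale t /\
    \sum_(s < t | scale s < a) scale s <= 2 * N%:R * (growth * a); last by [].
have g1 := growth_ge1; elim: t => [|t [IH1 IH2]].
  have s0 := ltW (scale_gt0 0); have g0 := le_trans ler01 g1.
  have N2 : (0 : rat) <= 2 * N%:R by rewrite mulr_ge0 ?ler0n.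
  by rewrite big_ord0; split; apply: mulr_ge0 => //; apply: mulr_ge0.
rewrite big_mkcond big_ord_recr -big_mkcond /=.
have le := scale_le (leqnSn t); have s0 := scale_gt0 t.
case: ifP => [lta|_]; last first.
  by rewrite addr0; split => //; apply: le_trans IH1 _; rewrite ler_pM2l // mulr_gt0.
have h : \sum_(s < t | scale s < a) scale s + scale t <= 2 * N%:R * scale t.+1.
  by rewrite scaleS mulrA growthE mulrDl mul1r lerD2r.
split=> //; apply: le_trans h _; rewrite scaleS ler_pM2l ?mulr_gt0 //.
by rewrite ler_pM2l ?ltW // (lt_le_trans ltr01).
Qed.

(** After exchanging the sums, a group contributes exactly the scales below its latency in [o]. *)
Lemma sum_late o t : \sum_(s < t) (late o s)%:R * scale s <=
  2 * N%:R * growth * \sum_j arrival d o (mem (G j)).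
Proof.
rewrite mulr_sumr.
have -> : \sum_(s < t) (late o s)%:R * scale s =
    \sum_j \sum_(s < t | scale s < arrival d o (mem (G j))) scale s.
  under [RHS]eq_bigr do rewrite big_mkcond.
  rewrite exchange_big; apply: eq_bigr => s _ /=.
  rewrite -big_mkcond /= sumr_const mulr_natl /late; congr (_ *+ _).
  by rewrite cardsE.
apply: ler_sum => j _; rewrite -mulrA.
exact/sum_scales_below/arrival_ge0.
Qed.

Lemma unhit_split P P' : {subset P <= P'} ->
  unhit P = (unhit P' + #|[set j | ~~ hit P j && hit P' j]|)%N.
Proof.
move=> sub.
have sub_hit j : hit P j -> hit P' j.
  by case/hasP => x xP xG; apply/hasP; exists x => //; apply: sub.
pose A := [set j | ~~ hit P j]; pose B := [set j | hit P' j].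
have EI : A :&: B = [set j | ~~ hit P j && hit P' j].
  by apply/setP => j; rewrite !inE.
have ED : A :\: B = [set j | ~~ hit P' j].
  apply/setP => j; rewrite !inE; have := sub_hit j.
  by case: (hit P j); case: (hit P' j) => // /(_ isT).
by rewrite /unhit -(cardsID B A) EI ED addnC.
Qed.

(* [S] is the sum of [unhit * scale] over the past phases. *)
Definition phase_inv t p : Prop :=
  simple_path p /\ closed_len d (ord0 :: p) <= 2 * Gam%:R * spent t /\
  (unhit (ord0 :: p) + (t - K) <= m)%N /\
  exists S : rat,
    hit_latency p + (unhit (ord0 :: p))%:R * (2 * Gam%:R * spent t) <=
      2 * Gam%:R * S /\
    forall o, mgl_feasible G o ->
      S / (2 * N%:R) + (unhit (ord0 :: p))%:R * scale t <=
        (unhit [:: ord0])%:R * b0 +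
        growth / N%:R * \sum_(s < t) (late o s)%:R * scale s.

Lemma phase_inv0 : phase_inv 0 [::].
Proof.
split=> //; split.
  rewrite /closed_len /spent big_ord0 /= addr0 mulr0.
  by case: dP => _ h _ _; rewrite (eqP (_ : d ord0 ord0 == 0)) // h.
split; first by rewrite sub0n addn0; apply: leq_trans (max_card _) _; rewrite card_ord.
exists 0; rewrite /spent !big_ord0 !mulr0 addr0; split.
  by rewrite /hit_latency big1 // => j _; rewrite /arrival; case: (find _ _).
by move=> o _; rewrite mul0r add0r big_ord0 mulr0 addr0 /scale expr0 mulr1.
Qed.

(* The part of [o] of length [scale t] reaches every group that is not late, and
   the tree reaches a share [1/N] of the groups newly reached by that part. *)
Lemma unhit_progress t p E o : mgl_feasible G o ->
  good_tree (ord0 :: p) (scale t) E ->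
  (unhit (ord0 :: p) <= N * #|[set j | ~~ hit (ord0 :: p) j &&
     hit (extend (ord0 :: p) (tour E)) j]| + late o t)%N.
Proof.
move=> [so ho] [trE _ covE].
have := covE _ (within_feasible d (ltW (scale_gt0 t)) so) => h.
have le1 : (#|[set j | ~~ hit (ord0 :: p) j && hit (tree_nodes E) j]| <=
    #|[set j | ~~ hit (ord0 :: p) j && hit (extend (ord0 :: p) (tour E)) j]|)%N.
  apply: subset_leq_card; apply/subsetP => j; rewrite !inE => /andP[-> h'].
  have /hasP[x xE xG] := h'; apply/hasP; exists x => //.
  by rewrite mem_extend (tree_nodes_sub_tour trE) ?orbT.
have le2 : (unhit (ord0 :: p) <= #|[set j | ~~ hit (ord0 :: p) j &&
    hit (ord0 :: within d (scale t) ord0 o) j]| + late o t)%N.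
  apply: leq_trans (leq_card_setU _ _); apply: subset_leq_card.
  apply/subsetP => j; rewrite !inE => -> /=.
  rewrite /hit; have [//|h'] := ltP (scale t) (arrival d o (mem (G j))).
    by rewrite orbT.
  by apply/orP; left; exact: (has_within dP (ho j) h').
apply: leq_trans le2 _; rewrite leq_add2r; apply: leq_trans h _.
by rewrite leq_mul2l le1 orbT.
Qed.

(** Each unreached group carries the allowance for the length spent so far as a debt, which settles
    its latency once it is reached. The potential, S/(2N) plus unreached count times scale, rises by
    at most growth/N times late count times scale: this is [key] multiplied by the scale. *)
Lemma phase_inv_step t p E : phase_inv t p -> (0 < unhit (ord0 :: p))%N ->
  good_tree (ord0 :: p) (scale t) E ->
  exists2 p', extend (ord0 :: p) (tour E) = ord0 :: p' & phase_inv t.+1 p'.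
Proof.
move=> [up [cl [cnt [S [lat pot]]]]] R_gt0 gE.
have [trE lenE _] := gE.
set W := tour E; set w := [seq v <- W | v \notin ord0 :: p].
exists (p ++ w); first by [].
have ext : extend (ord0 :: p) W = ord0 :: (p ++ w) by [].
have sub : {subset ord0 :: p <= ord0 :: p ++ w}.
  by move=> x; rewrite -ext mem_extend => ->.
have split_unhit := unhit_split sub.
set R := unhit (ord0 :: p) in R_gt0 lat pot cnt split_unhit.
set R' := unhit (ord0 :: p ++ w) in split_unhit *.
set new := #|_| in split_unhit.
have progress o : mgl_feasible G o -> (R <= N * new + late o t)%N.
  by move=> fo; exact: (unhit_progress fo gE).
have up' : simple_path (p ++ w).
  by rewrite /simple_path -ext; apply: uniq_extend => //; exact: uniq_tour.
have clW : closed_len d W <= 2 * (Gam%:R * scale t).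
  by apply: le_trans (closed_len_tour dP E) _; rewrite ler_pM2l.
have cl' : closed_len d (ord0 :: p ++ w) <= 2 * Gam%:R * spent t.+1.
  have -> : spent t.+1 = spent t + scale t by rewrite /spent big_ord_recr.
  (* Returning to the root before the new tour is no shorter than joining it directly; this is why
     closed lengths are kept in the invariant. *)
  have h1 : closed_len d (ord0 :: p ++ w) <= closed_len d (ord0 :: p) +
      walk_len ord0 (w ++ [:: ord0]).
    rewrite /closed_len /= -catA (walk_len_cat d ord0 p (w ++ _)).
    rewrite (walk_len_cat d ord0 p [:: ord0]) -addrA lerD2l /= addr0.
    exact: (walk_len_detour dP).
  have h2 : walk_len ord0 (w ++ [:: ord0]) <= closed_len d W.
    rewrite /w /closed_len; have [s ->] : exists s, W = ord0 :: s.
      by rewrite /W; case: (tour_inv_tour dP E) => _ [s ->]; exists s.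
    have -> : [seq v <- ord0 :: s | v \notin ord0 :: p] =
        [seq v <- s | v \notin ord0 :: p].
      by rewrite /= ?inE ?eqxx.
    exact: (walk_len_filter dP).
  by rewrite mulrDr; move: cl clW h1 h2; lra.
split=> //; split=> //; rewrite -/R'; split.
  have [tK|Kt] := ltnP t K.
    move: cnt split_unhit tK; move: (R) (R') (new) => a b c; clear; lia.
  (* From phase [K] on no group is late for [full], so [R <= N * new], and R > 0 forces a newly
     reached group. *)
  have late0 : late full t = 0%N.
    apply/eqP; rewrite cards_eq0; apply/eqP/setP => j; rewrite !inE.
    apply/negbTE; rewrite -leNgt; apply: le_trans (arrival_le dP _ _) _.
    exact: le_trans full_short (scale_le Kt).
  have := progress _ full_feasible; rewrite late0 addn0.
  move: cnt split_unhit Kt R_gt0; move: (R) (R') (new) => a b [|c].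
    by rewrite muln0; clear; lia.
  by clear; lia.
exists (S + R%:R * scale t); split.
  have -> : hit_latency (p ++ w) = hit_latency p +
      \sum_(j | ~~ hit (ord0 :: p) j && hit (ord0 :: p ++ w) j)
        arrival d (p ++ w) (mem (G j)).
    rewrite /hit_latency (bigID (hit (ord0 :: p))) /=; congr (_ + _).
      rewrite big_mkcond [RHS]big_mkcond; apply: eq_bigr => j _.
      have [h|h] := boolP (hit (ord0 :: p) j); last by rewrite andbF.
      rewrite andbT arrival_cat // ifT //.
      by case/hasP: h => x /sub xp xG; apply/hasP; exists x.
    by apply: eq_bigl => j; rewrite andbC.
  have le_new : \sum_(j | ~~ hit (ord0 :: p) j && hit (ord0 :: p ++ w) j)
      arrival d (p ++ w) (mem (G j)) <= new%:R * (2 * Gam%:R * spent t.+1).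
    apply: (@le_trans _ _ (\sum_(j | ~~ hit (ord0 :: p) j && hit (ord0 :: p ++ w) j)
        (2 * Gam%:R * spent t.+1))).
      apply: ler_sum => j _; apply: le_trans (arrival_le dP _ _) _.
      exact: le_trans (walk_len_closed dP _) cl'.
    by rewrite sumr_const /new cardsE -[leLHS]mulr_natl.
  have RE : (R%:R : rat) = R'%:R + new%:R by rewrite split_unhit natrD.
  have sE : spent t.+1 = spent t + scale t by rewrite /spent big_ord_recr.
  move: lat le_new; rewrite sE RE.
  set X := \sum_(j | _) _; move: (hit_latency p) X (spent t) (scale t) => h X x y.
  move: (R'%:R) (new%:R) (Gam%:R) => a b g lat le_new; lra.
move=> o fo; have {}pot := pot o fo; have {}progress := progress o fo.
rewrite big_ord_recr /= mulrDr scaleS.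
have sc := scale_gt0 t; have gr := growthE; have g1 := growth_ge1.
have RE : (R%:R : rat) = R'%:R + new%:R by rewrite split_unhit natrD.
have prog : (R%:R : rat) <= N%:R * new%:R + (late o t)%:R.
  by rewrite -natrM -natrD ler_nat.
have key : R%:R / (2 * N%:R) + growth * R'%:R <=
    R%:R + growth / N%:R * (late o t)%:R :> rat.
  have E1 : growth = 1 + (2 * N%:R)^-1 by [].
  have n2 : (2 * N%:R : rat) ^-1 = 2^-1 * N%:R^-1 by rewrite invfM.
  have NV : N%:R * N%:R^-1 = 1 :> rat by rewrite mulfV // lt0r_neq0.
  have iN : (0 : rat) < N%:R^-1 by rewrite invr_gt0.
  (* This is [prog] divided by N, with new = R - R'. *)
  have R'le : R'%:R <= R%:R - N%:R^-1 * R%:R + N%:R^-1 * (late o t)%:R :> rat.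
    have : N%:R^-1 * R%:R <= N%:R^-1 * (N%:R * new%:R + (late o t)%:R) :> rat.
      by rewrite ler_pM2l.
    by rewrite mulrDr mulrA mulVf ?lt0r_neq0 // mul1r RE; lra.
  have : growth * R'%:R <= growth * (R%:R - N%:R^-1 * R%:R + N%:R^-1 * (late o t)%:R).
    by rewrite ler_pM2l // (lt_le_trans ltr01).
  have Rge0 : (0 : rat) <= R%:R by rewrite ler0n.
  by rewrite E1 n2; exact: growth_absorbs.
have : (R%:R / (2 * N%:R) + growth * R'%:R) * scale t <=
    (R%:R + growth / N%:R * (late o t)%:R) * scale t by rewrite ler_pM2r.
rewrite mulrDl [in X in _ -> X]mulrDl.
move: pot; move: (growth / N%:R) ((2 * N%:R)^-1) (R%:R) (R'%:R) (scale t) growth.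
move: ((late o t)%:R) (\sum_(s < t) _) ((unhit _)%:R * b0) => l X c gN iN r r' x g.
move=> h1 h2; lra.
Qed.

(** With no debt left, the latency is at most 2 Gam S. The potential bounds S/(2N) by 1 + 2 growth^2
    times the latency of [o], at most 11/2 since growth <= 3/2; hence 22 = 2 * 11/2 * 2. *)
Lemma phase_inv_approx t p o : phase_inv t p -> unhit (ord0 :: p) = 0%N ->
  mgl_feasible G o ->
  mgl_feasible G p /\ mgl_latency d G p <= 22 * (N%:R * Gam%:R) * mgl_latency d G o.
Proof.
move=> [up [cl [_ [S [lat pot]]]]] R0 fo.
have allhit j : hit (ord0 :: p) j.
  move/eqP: R0; rewrite cards_eq0 => /eqP/setP/(_ j); rewrite !inE.
  by move/negbT; rewrite negbK.
split; first by split.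
have latE : hit_latency p = mgl_latency d G p.
  by apply: eq_bigl => j; rewrite allhit.
have := pot o fo; rewrite R0 !mul0r addr0 => {}pot.
rewrite R0 mul0r addr0 latE in lat.
have OPT0 : 0 <= mgl_latency d G o by apply: sumr_ge0 => j _; exact: arrival_ge0.
(* Each group not containing the root has latency at least [b0] in [o]. *)
have start : (unhit [:: ord0])%:R * b0 <= mgl_latency d G o.
  rewrite mulr_natl /unhit -sumr_const big_mkcond; apply: ler_sum => j _.
  rewrite inE /hit /= orbF; case: ifP => h; last exact: arrival_ge0.
  by apply: arrival_ge_dist => //; case: fo.
have mid := sum_late o t; rewrite -/(mgl_latency d G o) in mid.
have gl := growth_le; have g1 := growth_ge1.
have N1 := N0.
have h1 : growth / N%:R * \sum_(s < t) (late o s)%:R * scale s <=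
    growth / N%:R * (2 * N%:R * growth * mgl_latency d G o).
  by rewrite ler_pM2l // divr_gt0 // (lt_le_trans ltr01).
have E2 : growth / N%:R * (2 * N%:R * growth * mgl_latency d G o) =
    2 * growth ^+ 2 * mgl_latency d G o.
  by field; rewrite lt0r_neq0.
have h2 : growth ^+ 2 <= 9 / 4.
  have g0 := le_trans ler01 g1; rewrite expr2.
  by have := ler_pM g0 g0 gl gl; lra.
have h3 : S / (2 * N%:R) <= (11 / 2) * mgl_latency d G o.
  apply: le_trans pot _; rewrite E2 in h1.
  have : 2 * growth ^+ 2 * mgl_latency d G o <= 9 / 2 * mgl_latency d G o.
    by rewrite ler_wpM2r //; lra.
  by move: h1 start; lra.
have h4 : S <= 11 / 2 * mgl_latency d G o * (2 * N%:R).
  by rewrite -ler_pdivrMr // mulr_gt0.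
apply: le_trans lat _.
have : 2 * Gam%:R * S <= 2 * Gam%:R * (11 / 2 * mgl_latency d G o * (2 * N%:R)).
  by rewrite ler_wpM2l // mulr_ge0.
by move=> h; apply: le_trans h _; rewrite le_eqVlt; apply/orP; left; apply/eqP; field.
Qed.
End Phases.

(** * Evaluation of the main loop *)

Lemma enc_seq_map (T U : Type) (f : T -> data) (g : U -> T) s :
  enc_seq f (map g s) = enc_seq (f \o g) s.
Proof. by elim: s => //= x s IH; rewrite !enc_seq_cons IH. Qed.

Lemma expn_dominates S : (100 <= S)%N ->
  [/\ (100 * S <= S ^ 4)%N, (S <= S ^ 4)%N, (S ^ 2 <= S ^ 4)%N & (S ^ 3 <= S ^ 4)%N].
Proof.
move=> h; have S1 : (1 < S)%N by exact: leq_trans h.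
split; rewrite ?leq_exp2l //; last by rewrite -{1}[S]expn1 leq_exp2l.
rewrite (expnSr S 3) leq_mul2r; apply/orP; right; apply: leq_trans h _.
by rewrite -{1}[S]expn1 leq_exp2l.
Qed.

Lemma dsize_edges n (E : seq ('I_n.+1 * 'I_n.+1)) : is_tree E ->
  (dsize (enc_edges E) <= n.+1 * n.+1 * (2 * n + 6) + 1)%N.
Proof.
move=> tE; apply: leq_trans (dsize_enc_seq (b := (2 * n + 5)%N) _) _.
  move=> e _; rewrite /= dsize_cons.
  apply: (@leq_trans (n.+2 + n.+2).+1); last by lia.
  by rewrite ltnS leq_add // dsize_ord.
by rewrite leq_add2r -addnS leq_mul2r (size_tree_edges tE) orbT.
Qed.

Section Loop.
Variables (n m : nat) (d : 'M[rat]_n.+1) (G : 'I_m -> {set 'I_n.+1}).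
Variables (N Gam K : nat) (b0 : rat) (full : seq 'I_n.+1).
Hypothesis dP : is_metric d.
Hypothesis N_gt0 : (0 < N)%N.
Hypothesis b0_gt0 : 0 < b0.
Hypothesis b0_le : forall v, v != ord0 -> b0 <= d ord0 v.
Hypothesis full_feasible : mgl_feasible G full.
Hypothesis full_short : walk_len d ord0 full <= scale N b0 K.
Local Notation node := 'I_n.+1.
Local Notation nodes := (enc_seq (@enc_ord n.+1)).
Local Notation groups := (enc_fun (fun j => enc_set (G j))).

Variables (sub : behaviour) (init query : expr).
Let p := table init query (growth N).
Local Notation silent := (silent sub p).

Definition state P B : data :=
  Cons (Cons (enc_mx d) groups) (Cons (Num B) (nodes P)).

(** [T] bounds both the time of a call and the tosses it reads, [Tq] the construction of a query,
    [D] the code of a scale. [ask] abstracts from the two query formats. *)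
Variables (ask : ('I_m -> rat) -> rat -> data) (T Tq S L D : nat).
Let weights P j : rat := (~~ hit G P j)%:R.

Hypothesis leL : L = ((2 * n.+1) * n.+3 + 1)%N.
Hypothesis leS : (20 * L + 100 + 4 * (m * (L + 10)) + 4 * dsize (enc_mx d) +
  2 * (n.+1 * n.+1 * (2 * n + 6)) + 8 * D <= S)%N.
Hypothesis scaleD : forall t, (t <= K + m)%N -> (dsize (Num (scale N b0 t)) <= D)%N.

Hypothesis silent_query : forall P t, uniq P -> (t < K + m)%N ->
  silent [:: state P (scale N b0 t)] query (ask (weights P) (scale N b0 t)) Tq.

Hypothesis sub_good : forall P t, uniq P -> (t < K + m)%N ->
  forall w, (T <= size w)%N -> exists E w' t',
  [/\ sub (ask (weights P) (scale N b0 t)) w (enc_edges E) w' t',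
      good_tree d G N Gam P (scale N b0 t) E, (t' <= T)%N &
      (size w <= size w' + T)%N].

Let gs := [seq enum (G j) | j <- enum 'I_m].

Lemma groupsE : groups = enc_seq nodes gs.
Proof. by rewrite /gs enc_seq_map. Qed.

Lemma size_groups : {in gs, forall g, (size g <= n.+1)%N}.
Proof.
by move=> g /mapP[j _ ->]; rewrite -cardE; apply: leq_trans (max_card _) _; rewrite card_ord.
Qed.

Lemma size_gs : size gs = m.
Proof. by rewrite size_map size_enum_ord. Qed.

Lemma hitE P j : hit G P j = has (mem P) (enum (G j)).
Proof.
rewrite /hit has_sym; apply: eq_has => x /=.
by rewrite mem_enum.
Qed.

Lemma unhitE P : has (fun g => ~~ has (mem P) g) gs = (0 < unhit G P)%N.
Proof.
rewrite has_map card_gt0; apply/hasP/set0Pn => [[j _ h]|[j]].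
  by exists j; rewrite inE hitE.
by rewrite inE hitE => h; exists j; rewrite ?mem_enum.
Qed.

Let leL8 : (8 * ((2 * n.+1) * n.+3 + 1) + 50 <= S)%N.
Proof. by lia. Qed.

Let leG8 : (8 * ((2 * n.+1) * n.+3 + 1) + 50 +
   2 * (size gs * ((2 * n.+1) * n.+3 + 1 + 10)) <= S)%N.
Proof. by rewrite size_gs; lia. Qed.

Lemma dsize_state P t : uniq P -> (t <= K + m)%N ->
  (2 * dsize (state P (scale N b0 t)) + 20 <= S)%N.
Proof.
move=> uP tK; rewrite /state !dsize_cons groupsE.
have := dsize_groups size_groups; rewrite size_gs.
have := dsize_nodes (leq_trans (size_uniq_node uP) (leq_pmull _ (ltn0Sn 1))).
by have := scaleD tK; rewrite -leL; lia.
Qed.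

Lemma loop_test P t : uniq P -> (t <= K + m)%N ->
  silent [:: state P (scale N b0 t)]
    (Call 9 (pair (cdr (cdr (Var 0))) (cdr (car (Var 0)))))
    (enc_bool (0 < unhit G P)%N) (301 * S ^ 4).
Proof.
move=> uP tK; have := dsize_state uP tK; rewrite -unhitE /state groupsE !dsize_cons => dS.
have hl := silent_left sub init query (growth N) leL8 size_groups leG8 uP.
have [|S1 S4 _ _] := @expn_dominates S; first by lia.
apply: silent_le; first by apply: (silent_call _ hl); steps S.
by lia.
Qed.

Lemma loop_update P t E : uniq P -> (t < K + m)%N -> is_tree E ->
  silent [:: enc_edges E; state P (scale N b0 t)]
    (pair (car (Var 1))
       (pair (Op2 Mul (Lit (Num (growth N))) (car (cdr (Var 1))))
          (Call 7 (pair
             (Call 6 (pair (cdr (cdr (Var 1)))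
                (Call 5 (pair (Var 0) (car (car (Var 1)))))))
             (cdr (cdr (Var 1)))))))
    (state (extend P (tour E)) (scale N b0 t.+1))
    (1200 * S ^ 4 + 2 * dsize (Num (growth N))).
Proof.
move=> uP tK tE; have := dsize_state uP (ltnW tK); rewrite /state !dsize_cons => dS.
have dE := dsize_edges tE.
have uT := uniq_tour E; have uX := uniq_extend uP uT.
have dT := dsize_nodes (leq_trans (size_uniq_node uT) (leq_pmull _ (ltn0Sn 1))).
have dPn := dsize_nodes (leq_trans (size_uniq_node uP) (leq_pmull _ (ltn0Sn 1))).
have dX := dsize_nodes (leq_trans (size_uniq_node uX) (leq_pmull _ (ltn0Sn 1))).
have dF : (dsize (nodes [seq v <- tour E | v \notin P]) <= L)%N.
  rewrite leL; apply: dsize_nodes; apply: leq_trans (leq_pmull _ (ltn0Sn 1)).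
  by apply: size_uniq_node; rewrite filter_uniq.
have d1 := scaleD tK; have d0 := scaleD (ltnW tK).
have dg : (dsize (Num (growth N)) <= dsize (Num (growth N)))%N by [].
rewrite -leL in dT dPn dX *.
have h5 : silent [:: Cons (enc_edges E) (enc_mx d)] (nth (Lit Nil) p 5)
    (nodes (tour E)) (700 * S ^ 4).
  by apply: silent_tour => //; rewrite -leL; lia.
have h6 := silent_filter sub init query (growth N) leL8 uP uT.
have h7 := silent_cat sub init query (growth N) leL8 uX.
have [|S1 _ S2 S4] := @expn_dominates S; first by lia.
apply: silent_le.
  apply: (silent_op2 (S := (2 * S)%N)); [by steps S | | by [] |].
    apply: (silent_op2 (S := (2 * S)%N)); [ | | by [] |].
    + apply: (silent_op2 (v2 := Num (scale N b0 t)) (S := (dsize (Num (growth N)) + 2 * S)%N)).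
      * exact: silent_lit.
      * by steps S.
      * by rewrite /= -scaleS.
      * by lia.
    + apply: (silent_call _ h7).
      apply: (silent_op2 (S := (2 * S)%N)); [ | by steps S | by [] |].
        apply: (silent_call _ h6).
        apply: (silent_op2 (S := (2 * S)%N)); [by steps S | | by [] |].
          by apply: (silent_call _ h5); steps S.
        by rewrite !dsize_cons; lia.
      by rewrite !dsize_cons; lia.
    by rewrite !dsize_cons; lia.
  by rewrite !dsize_cons; lia.
by lia.
Qed.

Lemma loop_stop k t q w u1 : (t <= K + m)%N ->
  phase_inv d G N Gam K b0 t q -> unhit G (ord0 :: q) = 0%N ->
  eval sub p [:: state (ord0 :: q) (scale N b0 t)]
    (Call 9 (pair (cdr (cdr (Var 0))) (cdr (car (Var 0))))) w Nil w u1 ->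
  (u1 <= 301 * S ^ 4)%N ->
  exists q' t' w' u,
  [/\ eval sub p [:: state (ord0 :: q) (scale N b0 t)] (nth (Lit Nil) p 1) w
        (enc_path q') w' u,
      phase_inv d G N Gam K b0 t' q', unhit G (ord0 :: q') = 0%N &
      (u <= k.+1 * (T + Tq + 2000 * S ^ 4 + 2 * dsize (Num (growth N))))%N].
Proof.
move=> tK inv R0 ev1 leu1; have [uq _] := inv.
have dS := dsize_state uq tK.
have [|S1 _ _ _] := @expn_dominates S; first by lia.
have s3 : silent [:: state (ord0 :: q) (scale N b0 t)] (cdr (cdr (Var 0)))
    (enc_path q) (5 * S).
  rewrite /state !dsize_cons in dS *.
  by apply: silent_le; [steps S | lia].
have [u3 ev3 leu3] := s3 w.
exists q, t, w; eexists; split; [exact: (EvalIfFalse _ ev1 ev3) | by [] | by [] |].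
apply: (@leq_trans (T + Tq + 2000 * S ^ 4 + 2 * dsize (Num (growth N)))); last first.
  exact: leq_pmull.
have S0 : (0 < S)%N by lia.
by clear -leu1 leu3 S1 S0; lia.
Qed.

(** [k] bounds the phases still to come. By the count in the invariant nothing is unreached at phase
    K + m, so k = 0 leaves only the stopping case. A phase reads at most [T] tosses. *)
Lemma loop_runs k t q w : (K + m <= t + k)%N -> (t <= K + m)%N ->
  phase_inv d G N Gam K b0 t q ->
  (k * T <= size w)%N ->
  exists q' t' w' u,
  [/\ eval sub p [:: state (ord0 :: q) (scale N b0 t)] (nth (Lit Nil) p 1) w
        (enc_path q') w' u,
      phase_inv d G N Gam K b0 t' q', unhit G (ord0 :: q') = 0%N &
      (u <= k.+1 * (T + Tq + 2000 * S ^ 4 + 2 * dsize (Num (growth N))))%N].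
Proof.
elim: k t q w => [|k IH] t q w le tK inv sw.
all: have [uq [_ [cnt _]]] := inv; have [u1 ev1 leu1] := loop_test uq tK w.
all: have [|S1 _ _ _] := @expn_dominates S; first by lia.
all: have [R0|R_gt0] := posnP (unhit G (ord0 :: q)).
- by rewrite R0 in ev1; exact: (loop_stop _ tK inv R0 ev1 leu1).
- by clear -le cnt R_gt0; lia.
- by rewrite R0 in ev1; exact: (loop_stop _ tK inv R0 ev1 leu1).
have tK' : (t < K + m)%N by clear -cnt R_gt0; lia.
have [u2 ev2 leu2] := silent_query uq tK' w.
have [|E [w1 [u3 [ev3 goodE leu3 sw1]]]] := sub_good uq tK' (w := w).
  by apply: leq_trans sw; rewrite mulSn leq_addr.
have [q1 Eq1 inv1] := phase_inv_step dP N_gt0 b0_gt0 full_feasible full_short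
  inv R_gt0 goodE.
have [trE _ _] := goodE.
have [u4 ev4 leu4] := loop_update uq tK' trE w1.
rewrite Eq1 in ev4.
have [|//||q' [t' [w' [u5 [ev5 inv' R' leu5]]]]] := IH _ _ w1 _ _ inv1.
- by clear -le; lia.
- by move: sw sw1; rewrite mulSn; clear; lia.
rewrite R_gt0 in ev1.
have nz : enc_bool true <> Nil by [].
exists q', t', w'; eexists; split; [ | exact: inv' | exact: R' | ].
  exact: (EvalIfTrue _ ev1 nz (EvalLet (EvalAsk ev2 ev3) (EvalCall ev4 ev5))).
rewrite mulSn; apply: leq_trans (leq_add (leqnn _) leu5).
have S0 : (0 < S)%N by lia.
by clear -leu1 leu2 leu3 leu4 S1 S0; lia.
Qed.

End Loop.

(** * Bit sizes *)

Lemma bitlen_gt k : (k < 2 ^ bitlen k)%N.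
Proof. exact: trunc_log_ltn. Qed.

Lemma rat_le_pow (q : rat) : 0 <= q -> q <= 2 ^+ dsize (Num q).
Proof.
move=> q0; rewrite -{1}[q]divq_num_den.
have dq : (1 : rat) <= (denq q)%:~R by rewrite ler1z; have := denq_gt0 q; lia.
have nq : (numq q)%:~R = (`|numq q|%N)%:R :> rat.
  by rewrite -{1}(@gez0_abs (numq q)) ?numq_ge0.
apply: (@le_trans _ _ ((numq q)%:~R)).
  by rewrite ler_pdivrMr ?(lt_le_trans ltr01) // ler_peMr // nq ler0n.
rewrite nq -natrX ler_nat; apply: ltnW; apply: leq_trans (bitlen_gt _) _.
by rewrite leq_exp2l // /dsize leq_addr.
Qed.

Lemma rat_ge_pow (q : rat) : 0 < q -> (2 ^+ dsize (Num q))^-1 <= q.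
Proof.
move=> q0; have p0 : (0 : rat) < 2 ^+ dsize (Num q) by rewrite exprn_gt0.
have d0 : (0 : rat) < (denq q)%:~R by rewrite ltr0z denq_gt0.
have n1 : (1 : rat) <= (numq q)%:~R by rewrite ler1z; have := numq_gt0 q; rewrite q0; lia.
apply: (@le_trans _ _ ((denq q)%:~R^-1)).
  rewrite lef_pV2 ?posrE //.
  have -> : (denq q)%:~R = (`|denq q|%N)%:R :> rat.
    by rewrite -{1}(@gez0_abs (denq q)) ?denq_ge0.
  rewrite -natrX ler_nat; apply: ltnW; apply: leq_trans (bitlen_gt _) _.
  by rewrite leq_exp2l // /dsize leq_addl.
by rewrite -{2}[q]divq_num_den ler_peMl // invr_ge0 ltW.
Qed.

Lemma bitlen_mul a b : (bitlen (a * b) <= bitlen a + bitlen b)%N.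
Proof.
rewrite {1}/bitlen; case: (posnP (a * b)) => [->|ab0].
  by rewrite trunc_log0 /bitlen; lia.
rewrite -(@ltn_exp2l 2) //; apply: leq_ltn_trans (trunc_logP _ ab0) _ => //.
by rewrite expnD; apply: ltn_mul; exact: bitlen_gt.
Qed.

Lemma bitlen_mono a b : (a <= b)%N -> (bitlen a <= bitlen b)%N.
Proof. by move=> ab; rewrite /bitlen ltnS leq_trunc_log. Qed.

(** By coprimality, the reduced numerator of a product divides the product of the numerators, and
    likewise for denominators. A zero product is treated apart because divisibility bounds only
    divisors of positive numbers. *)
Lemma dsize_mul (a b : rat) :
  (dsize (Num (a * b)) <= dsize (Num a) + dsize (Num b))%N.
Proof.
rewrite /dsize addnACA.
have [->|ab0] := eqVneq (a * b) 0.
  rewrite (_ : numq 0 = 0) // (_ : denq 0 = 1) //.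
  have h k : (0 < bitlen k)%N by [].
  have := h `|numq a|%N; have := h `|numq b|%N; have := h `|denq a|%N.
  by rewrite /= bitlen1 /bitlen trunc_log0; lia.
have Emul : (numq (a * b) * (denq a * denq b) = (numq a * numq b) * denq (a * b))%R.
  apply: (@intr_inj rat); rewrite !intrM.
  by rewrite !numqE; ring.
have cop := coprime_num_den (a * b).
have Eabs : (`|numq (a * b)| * (`|denq a| * `|denq b|) =
    (`|numq a| * `|numq b|) * `|denq (a * b)|)%N by rewrite -!abszM Emul.
have dvd1 : (`|numq (a * b)| %| `|numq a| * `|numq b|)%N.
  by rewrite -(Gauss_dvdl _ cop) -Eabs dvdn_mulr.
have dvd2 : (`|denq (a * b)| %| `|denq a| * `|denq b|)%N.
  by rewrite -(@Gauss_dvdr _ `|numq (a * b)|%N) 1?coprime_sym // Eabs dvdn_mull.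
apply: leq_add.
  apply: leq_trans (bitlen_mul _ _); apply: bitlen_mono; apply: dvdn_leq => //.
  by move: ab0; rewrite mulf_eq0 negb_or -!numq_eq0 muln_gt0 !absz_gt0 => /andP[-> ->].
apply: leq_trans (bitlen_mul _ _); apply: bitlen_mono; apply: dvdn_leq => //.
by rewrite muln_gt0 !absz_gt0 !denq_eq0.
Qed.

Lemma bernoulli (x : rat) k : 0 <= x -> 1 + k%:R * x <= (1 + x) ^+ k.
Proof.
move=> x0; elim: k => [|k IH]; first by rewrite mul0r addr0 expr0.
rewrite exprS; have : (1 + x) * (1 + k%:R * x) <= (1 + x) * (1 + x) ^+ k.
  by rewrite ler_pM2l // ltr_pwDl.
apply: le_trans; have : 0 <= k%:R * x * x by rewrite !mulr_ge0 // ler0n.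
by rewrite -natr1; lra.
Qed.

Section Sizes.
Variable N : nat.
Hypothesis N_gt0 : (0 < N)%N.

(** The inequality of Bernoulli gives (1 + 1/(2N))^(2N) >= 2. *)
Lemma growth_double k : 2 ^+ k <= growth N ^+ (2 * N * k) :> rat.
Proof.
have N0 : (0 : rat) < 2 * N%:R by rewrite mulr_gt0 // ltr0n.
have i0 : 0 <= (2 * N%:R : rat)^-1 by rewrite invr_ge0 ltW.
rewrite exprM lerXn2r ?nnegrE ?exprn_ge0 ?ler0n //.
  by apply: le_trans ler01 _; rewrite lerDl.
by have := bernoulli (2 * N) i0; rewrite natrM mulfV ?lt0r_neq0.
Qed.

(** For data of size s a path through all nodes has length at most s 2^s <= 2^(2s), and the first
    scale is at least 2^-(s+3). So 3s + 3 doublings suffice, each taking 2N phases. *)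
Definition phase_bound s : nat := (2 * N * (3 * s + 3))%N.

Lemma dsize_scale b0 t :
  (dsize (Num (scale N b0 t)) <= t * dsize (Num (growth N)) + dsize (Num b0))%N.
Proof.
elim: t => [|t IH]; first by rewrite /scale expr0 mulr1 mul0n.
by rewrite scaleS; apply: leq_trans (dsize_mul _ _) _; rewrite mulSn; lia.
Qed.

Definition scale_size s : nat :=
  ((phase_bound s + s) * dsize (Num (growth N)) + s + 3)%N.

(** The size parameter of all cost bounds, as a polynomial in the input size: it dominates node
    lists, groups, matrix, trees and scales at once. *)
Definition data_bound s : nat :=
  let L := (2 * s * (s + 2) + 1)%N in
  (20 * L + 100 + 4 * (s * (L + 10)) + 4 * s + 2 * (s * s * (2 * s + 6)) +
  8 * scale_size s)%N.
End Sizes.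

(** * The reference path through all nodes and the first scale *)

Definition full_path n : seq 'I_n.+1 := [seq lift ord0 i | i <- enum 'I_n].

Lemma full_path_simple n : simple_path (full_path n).
Proof. by rewrite /simple_path /full_path -enum_ordSl enum_uniq. Qed.

Lemma mem_full_path n (v : 'I_n.+1) : v \in ord0 :: full_path n.
Proof. by rewrite /full_path -enum_ordSl mem_enum. Qed.

Lemma full_path_feasible n m (G : 'I_m -> {set 'I_n.+1}) :
  (forall j, G j != set0) -> mgl_feasible G (full_path n).
Proof.
move=> ne; split=> [|j]; first exact: full_path_simple.
have /set0Pn[v vG] := ne j; apply/hasP; exists v => //; exact: mem_full_path.
Qed.

Lemma dsize_mem_enc (T : eqType) (f : T -> data) s x : x \in s ->
  (dsize (f x) <= dsize (enc_seq f s))%N.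
Proof.
elim: s => //= y s IH; rewrite enc_seq_cons dsize_cons in_cons.
by move=> /orP[/eqP -> | /IH]; lia.
Qed.

Lemma dsize_row n (d : 'M[rat]_n.+1) u :
  (dsize (enc_seq (fun j => Num (d u j)) (enum 'I_n.+1)) <= dsize (enc_mx d))%N.
Proof.
exact: (@dsize_mem_enc _ (fun i => enc_fun (fun j => Num (d i j))) _ u (mem_enum _ _)).
Qed.

Lemma dsize_entry n (d : 'M[rat]_n.+1) u v : (dsize (Num (d u v)) <= dsize (enc_mx d))%N.
Proof.
apply: leq_trans (dsize_row d u).
exact: (@dsize_mem_enc _ (fun j => Num (d u j)) _ v (mem_enum _ _)).
Qed.

Definition first_scale n (d : 'M[rat]_n.+1) : rat :=
  least_positive [seq d ord0 j | j <- enum 'I_n.+1].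

Lemma least_positive_gt0 l : 0 < least_positive l.
Proof.
elim: l => [|e l IH] //=; rewrite /least_positive /= -/(least_positive l).
by have [//|e0] := leP e 0; case: ifP.
Qed.

Lemma least_positive_le l e : e \in l -> 0 < e -> least_positive l <= e.
Proof.
elim: l => //= f l IH; rewrite in_cons /least_positive /= -/(least_positive l).
move=> /orP[/eqP -> e0|el e0].
  by rewrite [f <= 0]leNgt e0 /=; case: ifP => // /negbT; rewrite -ltNge => /ltW.
have := IH el e0; have [//|f0] := leP f 0.
by case: ifP => // h1 h2; apply: le_trans h2.
Qed.

Lemma first_scale_le n (d : 'M[rat]_n.+1) v : is_metric d -> v != ord0 ->
  first_scale d <= d ord0 v.
Proof.
case=> d0 dE _ _ v0; apply: least_positive_le.
  by apply/mapP; exists v => //; rewrite mem_enum.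
by rewrite lt_neqAle d0 andbT eq_sym dE eq_sym.
Qed.

Lemma dsize_first_scale n (d : 'M[rat]_n.+1) :
  (dsize (Num (first_scale d)) <= dsize (enc_mx d) + 3)%N.
Proof.
rewrite /first_scale.
apply: leq_trans (dsize_least_positive _) _. rewrite addnC leq_add2r enc_seq_map.
exact: dsize_row.
Qed.

Lemma walk_len_pow n (d : 'M[rat]_n.+1) u p : is_metric d ->
  walk_len d u p <= (size p)%:R * 2 ^+ dsize (enc_mx d).
Proof.
case=> d0 _ _ _; elim: p u => [|v p IH] u /=; first by rewrite mul0r.
rewrite -nat1r mulrDl mul1r lerD //; apply: le_trans (rat_le_pow (d0 u v)) _.
by rewrite ler_weXn2l ?ler1n // dsize_entry.
Qed.

Lemma full_path_short N n (d : 'M[rat]_n.+1) s : (0 < N)%N -> is_metric d ->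
  (n.+1 <= s)%N -> (dsize (enc_mx d) <= s)%N ->
  walk_len d ord0 (full_path n) <= scale N (first_scale d) (phase_bound N s).
Proof.
move=> N0 dP ns ds.
have p2 k : (0 : rat) < 2 ^+ k by rewrite exprn_gt0.
have mono i j : (i <= j)%N -> 2 ^+ i <= 2 ^+ j :> rat.
  by move=> ij; rewrite ler_weXn2l // ler1n.
apply: (@le_trans _ _ (2 ^+ (s + s))).
  apply: le_trans (walk_len_pow _ _ dP) _; rewrite exprD ler_pM ?exprn_ge0 //.
    rewrite size_map size_enum_ord -natrX ler_nat.
    by apply: leq_trans (ltnW (ltn_expl s (ltnSn 1))); exact: ltnW.
  exact: mono.
rewrite /scale /phase_bound.
apply: (@le_trans _ _ ((2 ^+ (s + 3))^-1 * 2 ^+ (3 * s + 3))).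
  rewrite mulrC ler_pdivlMr // -exprD mono //; lia.
apply: ler_pM; [by rewrite invr_ge0 ltW | exact: ltW | | exact: growth_double].
have b0 : 0 < first_scale d by exact: least_positive_gt0.
apply: le_trans (rat_ge_pow b0); rewrite lef_pV2 ?posrE // mono //.
by apply: leq_trans (dsize_first_scale d) _; rewrite leq_add2r.
Qed.

(** * A complete run from an initial state *)

Section CoreRun.
Variables (n m : nat) (d : 'M[rat]_n.+1) (G : 'I_m -> {set 'I_n.+1}).
Variables (N Gam s : nat).
Hypothesis dP : is_metric d.
Hypothesis N_gt0 : (0 < N)%N.
Hypothesis G_ne : forall j, G j != set0.
Hypothesis ns : (n.+1 <= s)%N.
Hypothesis ms : (m <= s)%N.
Hypothesis ds : (dsize (enc_mx d) <= s)%N.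
Local Notation b0 := (first_scale d).
Local Notation K := (phase_bound N s).
Local Notation S := (data_bound N s).
Local Notation L := ((2 * n.+1) * n.+3 + 1)%N.

Lemma L_le : (L <= 2 * s * (s + 2) + 1)%N.
Proof. by rewrite leq_add2r -!mulnA leq_mul2l leq_mul //; lia. Qed.

Lemma data_bound_ge : (20 * L + 100 + 4 * (m * (L + 10)) + 4 * dsize (enc_mx d) +
  2 * (n.+1 * n.+1 * (2 * n + 6)) + 8 * scale_size N s <= S)%N.
Proof.
have lL := L_le; rewrite /data_bound.
have h1 : (m * (L + 10) <= s * (2 * s * (s + 2) + 1 + 10))%N by rewrite leq_mul // leq_add2r.
have h2 : (n.+1 * n.+1 * (2 * n + 6) <= s * s * (2 * s + 6))%N.
  by rewrite !leq_mul //; lia.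
by move: ds lL h1 h2; clear; lia.
Qed.

Lemma scale_size_ge t : (t <= K + m)%N ->
  (dsize (Num (scale N b0 t)) <= scale_size N s)%N.
Proof.
move=> tK; apply: leq_trans (dsize_scale N_gt0 _ _) _; rewrite /scale_size -addnA.
apply: leq_add; last by apply: leq_trans (dsize_first_scale d) _; rewrite leq_add2r.
by rewrite leq_mul2r; apply/orP; right; lia.
Qed.

Variables (sub : behaviour) (init query : expr) (x : data).
Variables (ask : ('I_m -> rat) -> rat -> data) (T : nat).

Hypothesis silent_init : silent sub (table init query (growth N)) [:: x] init
  (state d G [:: ord0] b0) (1000 * S ^ 4).

Hypothesis silent_query : forall P t, uniq P -> (t < K + m)%N ->
  silent sub (table init query (growth N)) [:: state d G P (scale N b0 t)] query
    (ask (fun j => (~~ hit G P j)%:R) (scale N b0 t)) (1000 * S ^ 4).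

Hypothesis sub_good : forall P t, uniq P -> (t < K + m)%N ->
  forall w, (T <= size w)%N -> exists E w' t',
  [/\ sub (ask (fun j => (~~ hit G P j)%:R) (scale N b0 t)) w (enc_edges E) w' t',
      good_tree d G N Gam P (scale N b0 t) E, (t' <= T)%N &
      (size w <= size w' + T)%N].

Lemma core_run w : ((K + s) * T <= size w)%N -> exists q w' u,
  [/\ run sub (table init query (growth N)) x w (enc_path q) w' u,
      mgl_feasible G q,
      forall o, mgl_feasible G o ->
        mgl_latency d G q <= 22 * (N%:R * Gam%:R) * mgl_latency d G o &
      (u <= (K + s + 2) * (T + 3000 * S ^ 4 + 2 * dsize (Num (growth N))))%N].
Proof.
move=> sw; have [u1 ev1 leu1] := silent_init w.
have b0_gt0 : 0 < b0 by exact: least_positive_gt0.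
have ff := full_path_feasible G_ne.
have fs := full_path_short N_gt0 dP ns ds.
have [||||q [t [w' [u [ev inv R0 leu]]]]] := @loop_runs n m d G N Gam K b0 _ dP N_gt0
  b0_gt0 ff fs sub init query ask T _ _ _ _ (erefl L) data_bound_ge scale_size_ge
  silent_query sub_good (K + m)%N 0%N [::] w.
- by rewrite add0n.
- by [].
- exact: phase_inv0.
- by apply: leq_trans sw; rewrite leq_mul2r leq_add2l ms orbT.
exists q, w'; eexists; split.
- apply: (EvalCall ev1); rewrite /scale expr0 mulr1 in ev; exact: ev.
- by case: (phase_inv_approx dP N_gt0 b0_gt0 (fun v => first_scale_le dP) inv R0 ff).
- by move=> o fo; case: (phase_inv_approx dP N_gt0 b0_gt0 (fun v => first_scale_le dP) inv R0 fo).
have le : ((K + m).+1 * (T + 1000 * S ^ 4 + 2000 * S ^ 4 + 2 * dsize (Num (growth N))) <=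
    (K + s + 1) * (T + 3000 * S ^ 4 + 2 * dsize (Num (growth N))))%N.
  by apply: leq_mul; [move: ms; clear; lia | clear; lia].
have S1 : (0 < S ^ 4)%N by rewrite expn_gt0 /data_bound addnS.
set X := (T + 3000 * S ^ 4 + 2 * dsize (Num (growth N)))%N in le *.
have -> : ((K + s + 2) * X = X + (K + s + 1) * X)%N.
  by rewrite -mulSn; congr (_ * _)%N; clear; lia.
move: (leq_trans leu le); move: ((K + s + 1) * X)%N => Y leY.
by move: leu1 leY S1; rewrite /X; move: (S ^ 4)%N => Z; clear; lia.
Qed.

End CoreRun.

(** * From oracle guarantees to runs *)

(** Rounding up loses a factor 2 at most. Applied to rho and to gamma, it turns the constant 22 into
    88. *)
Lemma exists_nat_bound (R : realType) (x : R) : 1 <= x ->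
  exists2 N : nat, (0 < N)%N & x <= N%:R /\ N%:R <= 2 * x.
Proof.
move=> x1; exists (Num.truncn x).+1 => //; split.
  exact/ltW/truncnS_gt.
rewrite -natr1; have : (Num.truncn x)%:R <= x by rewrite truncn_le // (le_trans ler01).
by lra.
Qed.

Lemma group_reward_unhit n m (G : 'I_m -> {set 'I_n.+1}) P s :
  group_reward G (fun j => (~~ hit G P j)%:R) s =
    #|[set j | ~~ hit G P j && hit G s j]|%:R.
Proof.
rewrite /group_reward -sum1_card natr_sum big_mkcond [RHS]big_mkcond.
by apply: eq_bigr => j _; rewrite inE /hit; case: (has _ s); case: (has _ P).
Qed.

(** The reward of an optimal path dominates that of any feasible [q]. With 0/1 weights both rewards
    are counts, so the real inequality descends to natural numbers. *)
Lemma tree_solution_good (R : realType) (rho gamma : R) n m (d : 'M[rat]_n.+1)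
    (G : 'I_m -> {set 'I_n.+1}) N Gam P B E :
  0 < rho -> rho <= N%:R -> gamma <= Gam%:R -> 0 <= B ->
  tree_solution d B (group_reward G (fun j => (~~ hit G P j)%:R)) rho gamma E ->
  good_tree d G N Gam P B E.
Proof.
move=> rho0 rN gG B0 [tE lE rE]; split=> //.
  rewrite -(ler_rat R) rmorphM /= ratr_nat; apply: le_trans lE _.
  by rewrite ler_wpM2r // ler0q.
move=> q fq; have [p optp] := orient_optimal_exists d
  (group_reward G (fun j => (~~ hit G P j)%:R)) B0.
have := optp.2 q fq; have := rE p optp; rewrite !group_reward_unhit !ratr_nat ler_nat.
rewrite ler_pdivrMl // => h1 h2; apply: leq_trans h2 _.
rewrite -(ler_nat R) natrM; apply: le_trans h1 _.
by rewrite ler_wpM2r.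
Qed.

(** Each call starts on the tape left by the earlier calls, so one bound must serve all sufficiently
    long tapes and must also limit the tosses consumed. *)
Definition answers n (A : algorithm) (x : data)
    (good : seq ('I_n.+1 * 'I_n.+1) -> Prop) (T : nat) : Prop :=
  forall w, (T <= size w)%N -> exists E w' t,
    [/\ exec A x w (enc_edges E) w' t, good E, (t <= T)%N &
        (size w <= size w' + T)%N].

Lemma answers_le n A x (good : seq ('I_n.+1 * 'I_n.+1) -> Prop) T T' :
  (T <= T')%N -> answers A x good T -> answers A x good T'.
Proof.
move=> le h w sw; have [E [w' [t [ev gE let' lw]]]] := h w (leq_trans le sw).
by exists E, w', t; split=> //; lia.
Qed.

Lemma size_take_tuple T (w : seq bool) : (T <= size w)%N -> size (take T w) == T.
Proof. by move=> h; rewrite size_takel. Qed.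

(** The tapes of length [T0] are finitely many, so their running times have a maximum; longer tapes
    only add unread tosses. *)
Lemma always_outputs_answers n A x (good : seq ('I_n.+1 * 'I_n.+1) -> Prop) :
  always_outputs A x (@enc_edges n) good -> exists T, answers A x good T.
Proof.
case=> T0 /choice[E hE].
have /choice[w' /choice[t ht]] : forall w : T0.-tuple bool, exists w' t,
    exec A x w (enc_edges (E w)) w' t /\ good (E w).
  by move=> w; have [w' [t h]] := hE w; exists w', t.
exists (maxn T0 (\max_w t w)) => w; rewrite geq_max => /andP[sw _].
pose w0 := Tuple (size_take_tuple sw); have [ev gE] := ht w0.
have [cat used _] := exec_regular A.
exists (E w0), (w' w0 ++ drop T0 w), (t w0); split => //.
- by have := cat _ _ _ _ _ (drop T0 w) ev; rewrite /= cat_take_drop.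
- by rewrite leq_max leq_bigmax orbT.
have := used _ _ _ _ _ ev; rewrite size_cat size_drop /= size_takel // => le.
have : (t w0 <= maxn T0 (\max_w t w))%N by rewrite leq_max leq_bigmax orbT.
by move: (sw) le; clear; lia.
Qed.

(* By determinism the short run given by the time bound and the run with a good
   output, which may be guaranteed on longer tapes only, are the same. *)
Lemma polytime_answers n A x (good : seq ('I_n.+1 * 'I_n.+1) -> Prop) T :
  always_outputs A x (@enc_edges n) good ->
  (forall w : T.-tuple bool, exists y w' t, exec A x w y w' t /\ (t <= T)%N) ->
  answers A x good T.
Proof.
case=> T0 hE hT w sw; have [y [w1 [t [ev lt]]]] := hT (Tuple (size_take_tuple sw)).
have [cat used det] := exec_regular A.
have ev1 := cat _ _ _ _ _ (drop T w) ev; rewrite /= cat_take_drop in ev1.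
have ev2 := cat _ _ _ _ _ (nseq T0 false) ev1.
have sw2 : (T0 <= size (w ++ nseq T0 false))%N by rewrite size_cat size_nseq leq_addl.
have [E [w2 [t2 [ev3 gE]]]] := hE (Tuple (size_take_tuple sw2)).
have ev4 := cat _ _ _ _ _ (drop T0 (w ++ nseq T0 false)) ev3.
rewrite /= cat_take_drop in ev4.
have [Ey _ _] := det _ _ _ _ _ _ _ _ ev2 ev4; subst y.
exists E, (w1 ++ drop T w), t; split=> //.
by have := used _ _ _ _ _ ev1; move: lt; clear; lia.
Qed.

(** A bound valid for each of the 2^T outcomes is valid for their average. *)
Lemma always_good_approximates (R : realType) (alpha : R) S A x (enc : S -> data)
    (feasible : S -> Prop) (cost : S -> rat) T :
  (forall w, (T <= size w)%N -> exists q w' u, [/\ exec A x w (enc q) w' u, feasible q &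
     forall o, feasible o -> ratr (cost q) <= alpha * ratr (cost o)]) ->
  approximates alpha A x enc feasible cost.
Proof.
move=> h; have /choice[out hout] : forall w : T.-tuple bool, exists q,
    exists w' u, [/\ exec A x w (enc q) w' u, feasible q &
      forall o, feasible o -> ratr (cost q) <= alpha * ratr (cost o)].
  by move=> w; apply: h; rewrite size_tuple.
exists T, out; split=> [w|p [fp _]].
  by have [w' [u [ev fw _]]] := hout w; split=> //; exists w', u.
rewrite ler_pdivrMr ?exprn_gt0 //.
apply: le_trans (_ : \sum_(w : T.-tuple bool) alpha * ratr (cost p) <= _).
  by apply: ler_sum => w _; have [w' [u [_ _ hw]]] := hout w; apply: hw.
by rewrite sumr_const card_tuple card_bool -[leLHS]mulr_natr natrX.
Qed.

(** * Polynomially bounded functions *)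

Definition poly_bounded (f : nat -> nat) : Prop :=
  exists c k : nat, forall s, (f s <= c * s ^ k + c)%N.

Lemma poly_bounded_const c : poly_bounded (fun=> c).
Proof. by exists c, 0%N => s; rewrite leq_addl. Qed.

Lemma poly_bounded_id : poly_bounded id.
Proof. by exists 1%N, 1%N => s; rewrite mul1n expn1 leq_addr. Qed.

(** The extra 1 covers s = 0 and i = 0, where 0^0 = 1. *)
Lemma leq_expS s i j : (i <= j)%N -> (s ^ i <= s ^ j + 1)%N.
Proof.
case: s => [|s] ij; last by rewrite addn1 leqW // leq_pexp2l.
by case: i {ij} => [|i]; rewrite ?expn0 ?leq_addl // exp0n.
Qed.

Lemma poly_bounded_add f g : poly_bounded f -> poly_bounded g ->
  poly_bounded (fun s => f s + g s)%N.
Proof.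
move=> [c1 [k1 h1]] [c2 [k2 h2]]; exists (2 * (c1 + c2))%N, (k1 + k2)%N => s.
have e1 := leq_expS s (leq_addr k2 k1); have e2 := leq_expS s (leq_addl k1 k2).
apply: leq_trans (leq_add (h1 s) (h2 s)) _.
move: e1 e2; move: (s ^ k1)%N (s ^ k2)%N (s ^ (k1 + k2))%N => a b c; clear; nia.
Qed.

Lemma poly_bounded_mul f g : poly_bounded f -> poly_bounded g ->
  poly_bounded (fun s => f s * g s)%N.
Proof.
move=> [c1 [k1 h1]] [c2 [k2 h2]]; exists (4 * (c1 * c2))%N, (k1 + k2)%N => s.
have e1 := leq_expS s (leq_addr k2 k1); have e2 := leq_expS s (leq_addl k1 k2).
apply: leq_trans (leq_mul (h1 s) (h2 s)) _.
have -> : ((c1 * s ^ k1 + c1) * (c2 * s ^ k2 + c2) =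
    c1 * c2 * (s ^ k1 * s ^ k2 + s ^ k1 + s ^ k2 + 1))%N.
  by rewrite !mulnDr !mulnDl !muln1; ring.
have -> : (4 * (c1 * c2) * s ^ (k1 + k2) + 4 * (c1 * c2) =
    c1 * c2 * (4 * s ^ (k1 + k2) + 4))%N by ring.
rewrite leq_mul2l; apply/orP; right; move: e1 e2; rewrite -expnD; clear; lia.
Qed.

Lemma poly_bounded_exp f k : poly_bounded f -> poly_bounded (fun s => f s ^ k)%N.
Proof.
move=> pf; elim: k => [|k IH].
  by have [c [j h]] := poly_bounded_const 1; exists c, j => s; rewrite expn0.
have [c [j h]] := poly_bounded_mul pf IH.
by exists c, j => s; rewrite expnS.
Qed.

Ltac poly := repeat first
  [ exact: poly_bounded_const | exact: poly_bounded_id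
  | apply: poly_bounded_add | apply: poly_bounded_mul | apply: poly_bounded_exp ].

Lemma data_bound_poly N : poly_bounded (data_bound N).
Proof. rewrite /data_bound /scale_size /phase_bound; poly. Qed.

Definition total_time N (T : nat -> nat) s : nat :=
  ((phase_bound N s + s + 2) * (T s + 3000 * data_bound N s ^ 4 +
   2 * dsize (Num (growth N))))%N.

Lemma total_time_poly N T : poly_bounded T -> poly_bounded (total_time N T).
Proof.
move=> pT; have pS := data_bound_poly N.
rewrite /total_time /phase_bound; apply: poly_bounded_mul; first by poly.
apply: poly_bounded_add; last by poly.
apply: poly_bounded_add => //; apply: poly_bounded_mul; first by poly.
exact: poly_bounded_exp.
Qed.

(** * The two reductions *)

Section Reduction.
Variables (R : realType) (rho gamma : R) (N Gam : nat).
Hypothesis rho_gt0 : 0 < rho.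
Hypothesis N_gt0 : (0 < N)%N.
Hypothesis rhoN : rho <= N%:R.
Hypothesis Nrho : N%:R <= 2 * rho.
Hypothesis gammaG : gamma <= Gam%:R.
Hypothesis Ggamma : Gam%:R <= 2 * gamma.

Variables (n m : nat) (d : 'M[rat]_n.+1) (G : 'I_m -> {set 'I_n.+1}) (s : nat).
Hypothesis dP : is_metric d.
Hypothesis G_ne : forall j, G j != set0.
Hypothesis ns : (n.+1 <= s)%N.
Hypothesis ms : (m <= s)%N.
Hypothesis ds : (dsize (enc_mx d) <= s)%N.
Local Notation b0 := (first_scale d).
Local Notation K := (phase_bound N s).
Local Notation S := (data_bound N s).

Variables (A : algorithm) (init query : expr) (x : data).
Variable ask : ('I_m -> rat) -> rat -> data.
Local Notation M := (table init query (growth N)).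
Let weights P j : rat := (~~ hit G P j)%:R.

Hypothesis silent_init : silent (exec A) M [:: x] init
  (state d G [:: ord0] b0) (1000 * S ^ 4).
Hypothesis silent_query : forall P t, uniq P -> (t < K + m)%N ->
  silent (exec A) M [:: state d G P (scale N b0 t)] query
    (ask (weights P) (scale N b0 t)) (1000 * S ^ 4).
Hypothesis ask_always : forall w B, (forall j, 0 <= w j) -> 0 <= B ->
  always_outputs A (ask w B) (@enc_edges n)
    (tree_solution d B (group_reward G w) rho gamma).

Let scale_ge0 t : 0 <= scale N b0 t.
Proof. exact/ltW/scale_gt0/least_positive_gt0. Qed.

Lemma reduction_run T :
  (forall P t, uniq P -> (t < K + m)%N ->
    answers A (ask (weights P) (scale N b0 t))
      (tree_solution d (scale N b0 t) (group_reward G (weights P)) rho gamma) T) ->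
  forall w, ((K + s) * T <= size w)%N -> exists q w' u,
    [/\ exec (Using M A) x w (enc_path q) w' u, mgl_feasible G q,
        forall o, mgl_feasible G o -> ratr (mgl_latency d G q) <=
          88 * (rho * gamma) * ratr (mgl_latency d G o) :> R &
        (u <= total_time N (fun=> T) s)%N].
Proof.
move=> good w sw.
have [|q [w' [u [ev fq lq lu]]]] := @core_run n m d G N Gam s dP N_gt0 G_ne ns ms ds
  (exec A) init query x ask T silent_init silent_query _ w sw.
  move=> P t uP tK v sv; have [E [v' [t' [ev tsol lt sv']]]] := good P t uP tK v sv.
  by exists E, v', t'; split=> //; apply: tree_solution_good tsol.
exists q, w', u; split=> // o fo.
have := lq o fo; rewrite -(ler_rat R) !rmorphM /= !ratr_nat => h.
apply: le_trans h _; apply: ler_wpM2r.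
  rewrite ler0q; apply: sumr_ge0 => j _; exact: arrival_ge0.
have : N%:R * Gam%:R <= (2 * rho) * (2 * gamma) by apply: ler_pM.
by lra.
Qed.

(** Each query has its own bound on the tape. A query is determined by the set of unreached groups
    and by t < K + m, so there are finitely many and the maximum serves them all. *)
Lemma reduction_approximates :
  exists T, forall w, (T <= size w)%N -> exists q w' u,
    [/\ exec (Using M A) x w (enc_path q) w' u, mgl_feasible G q &
        forall o, mgl_feasible G o -> ratr (mgl_latency d G q) <=
          88 * (rho * gamma) * ratr (mgl_latency d G o) :> R].
Proof.
have /choice[T hT] : forall Ut : {set 'I_m} * 'I_(K + m), exists T,
    answers A (ask (fun j => (j \in Ut.1)%:R) (scale N b0 Ut.2))
      (tree_solution d (scale N b0 Ut.2)
        (group_reward G (fun j => (j \in Ut.1)%:R)) rho gamma) T.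
  by move=> [U t]; apply: always_outputs_answers; apply: ask_always.
exists ((K + s) * \max_Ut T Ut)%N => w sw.
have [|q [w' [u [ev fq lq _]]]] := reduction_run _ sw; last by exists q, w', u.
move=> P t uP tK; pose U := [set j | ~~ hit G P j].
have -> : weights P = fun j => (j \in U)%:R.
  by apply/funext => j; rewrite /weights inE.
have := hT (U, Ordinal tK); apply: answers_le.
exact: (leq_bigmax (U, Ordinal tK)).
Qed.

Variables (valid : data -> Prop) (c k : nat).
Hypothesis A_time : forall y, valid y -> let T := (c * dsize y ^ k + c)%N in
  forall w : T.-tuple bool, exists z w' t, exec A y w z w' t /\ (t <= T)%N.
Hypothesis ask_valid : forall w B, (forall j, 0 <= w j) -> 0 <= B -> valid (ask w B).
Hypothesis ask_size : forall P t, uniq P -> (t < K + m)%N ->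
  (dsize (ask (weights P) (scale N b0 t)) <= S)%N.

(** Every query has size at most [S], so the polynomial of [A] evaluated at [S] is a common bound
    for all calls. *)
Lemma reduction_time w :
  (total_time N (fun s => c * data_bound N s ^ k + c) s <= size w)%N ->
  exists y w' u, exec (Using M A) x w y w' u /\
    (u <= total_time N (fun s => c * data_bound N s ^ k + c) s)%N.
Proof.
move=> sw.
have [||q [w' [u [ev _ _ lu]]]] := @reduction_run (c * S ^ k + c)%N _ w.
- move=> P t uP tK.
  have w0 j : 0 <= weights P j by rewrite ler0n.
  have := polytime_answers (ask_always w0 (scale_ge0 t))
    (A_time (ask_valid w0 (scale_ge0 t))).
  apply: answers_le; rewrite leq_add2r leq_mul2l; apply/orP; right.
  by case: (k) => [|k']; rewrite ?expn0 // leq_exp2r // ask_size.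
- apply: leq_trans sw; rewrite /total_time; apply: leq_mul.
    by rewrite leq_addr.
  by rewrite -addnA leq_addr.
by exists (enc_path q), w', u.
Qed.

End Reduction.

(** * Initial states and queries of the two problems *)

Definition root_path : expr := Lit (Cons (Num 0) Nil).

Definition mgl_init : expr :=
  pair (Var 0) (pair (Call 12 (pair (Lit Nil) (car (car (Var 0))))) root_path).

Definition go_query : expr :=
  pair (car (car (Var 0)))
    (pair (Call 10 (pair (cdr (cdr (Var 0))) (cdr (car (Var 0))))) (car (cdr (Var 0)))).

Definition ml_init : expr :=
  pair (pair (Var 0) (Call 14 (pair (Lit Nil) (Var 0))))
    (pair (Call 12 (pair (Lit Nil) (car (Var 0)))) root_path).

Definition po_query : expr :=
  pair (car (car (Var 0)))
    (pair (Call 11 (pair (cdr (cdr (Var 0))) (cdr (car (Var 0))))) (car (cdr (Var 0)))).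

Section Instances.
Variables (n m : nat) (d : 'M[rat]_n.+1) (G : 'I_m -> {set 'I_n.+1}) (N s : nat).
Hypothesis N_gt0 : (0 < N)%N.
Hypothesis ns : (n.+1 <= s)%N.
Hypothesis ms : (m <= s)%N.
Hypothesis ds : (dsize (enc_mx d) <= s)%N.
Local Notation b0 := (first_scale d).
Local Notation K := (phase_bound N s).
Local Notation S := (data_bound N s).
Local Notation L := ((2 * n.+1) * n.+3 + 1)%N.
Local Notation nodes := (enc_seq (@enc_ord n.+1)).
Local Notation groups := (enc_fun (fun j => enc_set (G j))).
Let gs := [seq enum (G j) | j <- enum 'I_m].
Variables (sub : behaviour) (init query : expr).
Local Notation M := (table init query (growth N)).
Let weights P j : rat := (~~ hit G P j)%:R.

Let big := data_bound_ge N_gt0 ns ms ds.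

Let leL8 : (8 * L + 50 <= S)%N.
Proof. by move: big; clear; lia. Qed.

Let leG8 : (8 * L + 50 + 2 * (size gs * (L + 10)) <= S)%N.
Proof. by rewrite size_gs; move: big; clear; lia. Qed.

Lemma weightsE P : weights P =1 fun j => weight P (enum (G j)).
Proof. by move=> j; rewrite /weights /weight hitE. Qed.

(** The root has index 0, so the program obtains the distances from the root by one [car]. *)
Lemma first_row : enc_mx d = Cons (enc_seq Num [seq d ord0 j | j <- enum 'I_n.+1])
  (enc_seq (fun i => enc_fun (fun j => Num (d i j))) [seq lift ord0 i | i <- enum 'I_n]).
Proof.
rewrite /enc_mx {1}/enc_fun [in LHS]enum_ordSl enc_seq_cons; congr (Cons _ _).
by rewrite enc_seq_map.
Qed.

Lemma enc_seq_ext (T : Type) (f g : T -> data) l : f =1 g -> enc_seq f l = enc_seq g l.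
Proof. by move=> fg; elim: l => //= y l IH; rewrite !enc_seq_cons fg IH. Qed.

Lemma root_pathE : Cons (Num 0) Nil = nodes [:: ord0].
Proof. by []. Qed.

Let pow4 : [/\ (100 * S <= S ^ 4)%N, (S <= S ^ 4)%N, (S ^ 2 <= S ^ 4)%N &
  (S ^ 3 <= S ^ 4)%N].
Proof. by apply: expn_dominates; move: big; clear; lia. Qed.

Lemma silent_first_scale env e T : silent sub M env e (enc_mx d) T ->
  silent sub M env (Call 12 (pair (Lit Nil) (car e))) (Num b0) (T + 200 * S ^ 4).
Proof.
move=> he; have dr := dsize_row d ord0; have [S1 S4 S2 S3] := pow4.
have dr' : (dsize (enc_seq Num [seq d ord0 j | j <- enum 'I_n.+1]) <= dsize (enc_mx d))%N.
  by rewrite enc_seq_map.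
have dm : (4 * dsize (enc_mx d) + 100 <= S)%N by move: big; clear; lia.
have hl : silent sub M [:: Cons Nil (enc_seq Num [seq d ord0 j | j <- enum 'I_n.+1])]
    (nth (Lit Nil) M 12) (Num b0) (100 * S ^ 2).
  by apply: (@silent_least_positive n); move: big dr'; clear; lia.
apply: silent_le.
  apply: (silent_call _ hl).
  apply: (silent_op2 (S := (2 * S)%N)); [by steps (data_bound N s) | | by [] |].
    apply: (silent_car (S := S)); first by rewrite first_row in he; exact: he.
    by rewrite -first_row; move: dm; clear; lia.
  by rewrite !dsize_cons !dsize_nil; move: dr' dm; clear; lia.
by rewrite dsize_nil; move: S1 S2 dm; clear; lia.
Qed.

Let big_groups : (4 * dsize groups + 100 <= S)%N.
Proof.
rewrite groupsE; have := dsize_groups (@size_groups n m G); rewrite size_gs.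
by move: big; clear; lia.
Qed.

Let big_mx : (4 * dsize (enc_mx d) + 100 <= S)%N.
Proof. by move: big; clear; lia. Qed.

Let big_scale t : (t <= K + m)%N -> (8 * dsize (Num (scale N b0 t)) + 100 <= S)%N.
Proof.
move=> tK; have := scale_size_ge N_gt0 ns ms ds tK.
by move: big; clear; lia.
Qed.

Let big_start : (8 * dsize (Num b0) + 100 <= S)%N.
Proof. by have := big_scale (leq0n _); rewrite /scale expr0 mulr1. Qed.

Let dsize_root : (dsize (nodes [:: ord0]) <= 4)%N.
Proof. by rewrite -root_pathE dsize_cons dsize_nil; have := dsize_num0; lia. Qed.

Lemma silent_state_init env e eB T1 T2 : silent sub M env e (Cons (enc_mx d) groups) T1 ->
  silent sub M env eB (Num b0) T2 ->
  silent sub M env (pair e (pair eB root_path)) (state d G [:: ord0] b0)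
    (T1 + T2 + 10 * S).
Proof.
move=> h1 h2; apply: silent_le.
  apply: (silent_op2 (S := (2 * S)%N) h1); last 2 first.
  - by rewrite /state.
  - move: big_groups big_mx big_start dsize_root.
    by rewrite /state !dsize_cons; clear; lia.
  apply: (silent_op2 (S := (2 * S)%N) h2 (silent_lit _ _ _ _)); first by rewrite root_pathE.
  by move: big_start dsize_root; rewrite root_pathE !dsize_cons; clear; lia.
by move: dsize_root big_mx; rewrite root_pathE; clear; lia.
Qed.

Lemma silent_mgl_init :
  silent sub M [:: enc_mgl d G] mgl_init (state d G [:: ord0] b0) (1000 * S ^ 4).
Proof.
have [S1 S4 S2 S3] := pow4; have S0 : (0 < S)%N by move: big; clear; lia.
apply: silent_le.
  apply: silent_state_init; first exact: silent_var.
  apply: silent_first_scale; apply: (silent_car (S := S)); first exact: silent_var.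
  by move: big_groups big_mx; rewrite dsize_cons; clear; lia.
by move: S0 S1; clear; lia.
Qed.

Section Query.
Variables (P : seq 'I_n.+1) (t : nat).
Hypothesis uP : uniq P.
Hypothesis tK : (t <= K + m)%N.
Local Notation B := (scale N b0 t).
Local Notation items := (enc_fun (fun j => Cons (enc_set (G j)) (Num (weights P j)))).

Let itemsE : items = enc_seq (fun g => Cons (nodes g) (Num (weight P g))) gs.
Proof. by rewrite enc_seq_map; apply: enc_seq_ext => j; rewrite /= -weightsE. Qed.

Let wtsE : enc_fun (fun j => Num (weights P j)) = enc_seq (fun g => Num (weight P g)) gs.
Proof. by rewrite enc_seq_map; apply: enc_seq_ext => j; rewrite /= -weightsE. Qed.

Let big_items : (4 * dsize items + 50 <= S)%N.
Proof.
rewrite itemsE /gs; have := dsize_items (@size_groups n m G) P; rewrite size_gs.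
by move: big; clear; lia.
Qed.

Let big_wts : (4 * dsize (enc_fun (fun j => Num (weights P j))) + 50 <= S)%N.
Proof.
rewrite wtsE; have := dsize_weights gs P; rewrite /gs size_gs.
by move: big; clear; lia.
Qed.

Lemma dsize_go : (dsize (enc_go d G (weights P) B) <= S)%N.
Proof.
move: big_items big_mx (big_scale tK); rewrite /enc_go !dsize_cons; clear; lia.
Qed.

Lemma dsize_po : (dsize (Cons (enc_mx d)
  (Cons (enc_fun (fun j => Num (weights P j))) (Num B))) <= S)%N.
Proof.
move: big_wts big_mx (big_scale tK); rewrite !dsize_cons; clear; lia.
Qed.

Let big_P : (4 * dsize (nodes P) + 50 <= S)%N.
Proof.
have := dsize_nodes (leq_trans (size_uniq_node uP) (leq_pmull _ (ltn0Sn 1))).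
by move: big; clear; lia.
Qed.

(** The two queries differ only in the function [f] called on the path and the groups: it lists the
    groups with their rewards, or the rewards alone. *)
Let query_shape f v T : silent sub M [:: Cons (nodes P) groups] (nth (Lit Nil) M f) v T ->
  (4 * dsize v + 50 <= S)%N ->
  silent sub M [:: state d G P B]
    (pair (car (car (Var 0)))
      (pair (Call f (pair (cdr (cdr (Var 0))) (cdr (car (Var 0))))) (car (cdr (Var 0)))))
    (Cons (enc_mx d) (Cons v (Num B))) (T + 100 * S).
Proof.
move=> hf bv; have b1 := big_P; have b2 := big_groups; have b3 := big_mx.
have b4 := big_scale tK; rewrite /state; clear -hf bv b1 b2 b3 b4.
apply: silent_le.
  apply: (silent_op2 (S := (2 * S)%N)); [by steps (data_bound N s) | | by [] |].
    apply: (silent_op2 (S := (2 * S)%N)); [ | by steps (data_bound N s) | by [] |].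
      by apply: (silent_call _ hf); steps (data_bound N s).
    by rewrite !dsize_cons; lia.
  by rewrite !dsize_cons; lia.
lia.
Qed.

Lemma silent_go_query : silent sub M [:: state d G P B] go_query
  (enc_go d G (weights P) B) (1000 * S ^ 4).
Proof.
have [S1 S4 S2 S3] := pow4.
have h := silent_items sub init query (growth N) leL8 (@size_groups n m G) leG8 uP.
rewrite -itemsE -/gs -groupsE in h.
apply: silent_le; first exact: (query_shape h big_items).
by move: S1; clear; lia.
Qed.

Lemma silent_po_query : silent sub M [:: state d G P B] po_query
  (Cons (enc_mx d) (Cons (enc_fun (fun j => Num (weights P j))) (Num B)))
  (1000 * S ^ 4).
Proof.
have [S1 S4 S2 S3] := pow4.
have h := silent_weights sub init query (growth N) leL8 (@size_groups n m G) leG8 uP.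
rewrite -wtsE -/gs -groupsE in h.
apply: silent_le; first exact: (query_shape h big_wts).
by move: S1; clear; lia.
Qed.

End Query.
End Instances.

Lemma tuple_run (A : algorithm) x F (T : nat) : (F <= T)%N ->
  (forall w, (F <= size w)%N -> exists y w' u, exec A x w y w' u /\ (u <= F)%N) ->
  forall w : T.-tuple bool, exists y w' t, exec A x w y w' t /\ (t <= T)%N.
Proof.
move=> FT h w; have [|y [w' [u [ev lu]]]] := h w; first by rewrite size_tuple.
by exists y, w', u; split=> //; exact: leq_trans lu FT.
Qed.

Lemma size_mgl_instance n m (d : 'M[rat]_n.+1) (G : 'I_m -> {set 'I_n.+1}) :
  [/\ (n.+1 <= dsize (enc_mgl d G))%N, (m <= dsize (enc_mgl d G))%N &
      (dsize (enc_mx d) <= dsize (enc_mgl d G))%N].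
Proof.
rewrite /enc_mgl dsize_cons.
have h1 : (n.+1 < dsize (enc_mx d))%N.
  by rewrite -{1}(size_enum_ord n.+1); exact: size_enc_seq.
have h2 : (m < dsize (enc_fun (fun j => enc_set (G j))))%N.
  by rewrite -{1}(size_enum_ord m); exact: size_enc_seq.
by split; lia.
Qed.

(** * Minimum latency as group latency of singletons *)

Section MinimumLatency.
Variables (n : nat) (d : 'M[rat]_n.+1).
Local Notation G := (fun v : 'I_n.+1 => [set v]).

Lemma has_set1 (v : 'I_n.+1) s : has (mem [set v]) s = (v \in s).
Proof. by rewrite -has_pred1; apply: eq_has => x /=; rewrite inE. Qed.

Lemma ml_feasibleE p : ml_feasible p <-> mgl_feasible G p.
Proof.
by split=> -[sp h]; split=> // v; have := h v; rewrite has_set1.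
Qed.

(** The singleton of the root is a group as well; it is reached at length 0 and adds nothing. *)
Lemma ml_latencyE p : ml_latency d p = mgl_latency d G p.
Proof.
rewrite /ml_latency /mgl_latency [RHS](bigD1 ord0) //=.
have -> : arrival d p (mem [set ord0]) = 0 by rewrite /arrival /= inE eqxx take0.
rewrite add0r; apply: eq_bigr => v _; rewrite /arrival.
suff -> : find (pred1 v) (ord0 :: p) = find (mem [set v]) (ord0 :: p) by [].
by apply: eq_find => x /=; rewrite inE.
Qed.

Lemma node_rewardE w s : node_reward w s = group_reward G w s.
Proof. by apply: eq_bigl => v; rewrite has_set1. Qed.

Lemma singleton_groupsE : enc_fun (fun v => enc_set (G v)) =
  enc_seq singleton_code (iota 0 n.+1).
Proof.
rewrite -val_enum_ord enc_seq_map; apply: enc_seq_ext => v.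
by rewrite /enc_set enum_set1.
Qed.

Lemma silent_ml_init N s sub query : (0 < N)%N -> (n.+1 <= s)%N ->
  (dsize (enc_mx d) <= s)%N ->
  silent sub (table ml_init query (growth N)) [:: enc_ml d] ml_init
    (state d G [:: ord0] (first_scale d)) (1000 * data_bound N s ^ 4).
Proof.
move=> N0 ns ds; have big := data_bound_ge N0 ns ns ds.
have [|S1 _ _ S3] := @expn_dominates (data_bound N s); first by move: big; clear; lia.
have hi : silent sub (table ml_init query (growth N)) [:: Cons Nil (enc_mx d)]
    (nth (Lit Nil) (table ml_init query (growth N)) 14)
    (enc_fun (fun v => enc_set (G v))) (200 * data_bound N s ^ 3).
  rewrite singleton_groupsE; apply: (@silent_iota n).
  - by move: big; clear; lia.
  - by rewrite size_enum_ord.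
  - by move: big; rewrite /enc_mx /enc_fun; clear; lia.
apply: silent_le.
  apply: (silent_state_init N0 ns ns ds).
    apply: (silent_op2 (S := (2 * data_bound N s)%N)); [exact: silent_var | | by [] |].
      apply: (silent_call _ hi).
      apply: (silent_op2 (S := (2 * data_bound N s)%N)).
      + exact: silent_lit.
      + exact: silent_var.
      + by [].
      + by rewrite /= dsize_cons dsize_nil; move: big; rewrite /enc_ml; clear; lia.
    have := dsize_groups (@size_groups n _ G); rewrite size_gs -groupsE /= !dsize_cons.
    by move: big; rewrite /enc_ml; clear; lia.
  by apply: (silent_first_scale N0 ns ns ds); exact: silent_var.
by rewrite dsize_nil; move: S1 S3 big; clear; lia.
Qed.

End MinimumLatency.

Theorem mainTheorem13 (R : realType) :
  (exists2 C : R, 0 < C &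
     forall rho gamma : R, 1 <= rho -> 1 <= gamma ->
     exists M : code, forall A : algorithm,
       po_tree_approx rho gamma A ->
       ml_approx (C * (rho * gamma)) (Using M A) /\
       (polytime po_input A -> polytime ml_input (Using M A)))
  /\
  (exists2 C : R, 0 < C &
     forall rho gamma : R, 1 <= rho -> 1 <= gamma ->
     exists M : code, forall A : algorithm,
       go_tree_approx rho gamma A ->
       mgl_approx (C * (rho * gamma)) (Using M A) /\
       (polytime go_input A -> polytime mgl_input (Using M A))).
Proof.
split; exists 88 => // rho gamma rho1 gamma1;
  have [N N0 [rN Nr]] := exists_nat_bound rho1;
  have [Gam Gam0 [gG Gg]] := exists_nat_bound gamma1;
  have rho0 := lt_le_trans ltr01 rho1.
- exists (table ml_init po_query (growth N)) => A hA.
  (* Node rewards are the group rewards of singletons, so the path-orienteering subroutine meets the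
     group guarantee expected by the loop. *)
  have always n (d : 'M[rat]_n.+1) : is_metric d -> forall w B, (forall j, 0 <= w j) ->
      0 <= B -> always_outputs A (enc_po d w B) (@enc_edges n)
      (tree_solution d B (group_reward (fun v => [set v]) w) rho gamma).
    move=> dP w B w0 B0.
    have <- : node_reward w = group_reward (fun v => [set v]) w.
      by apply/funext => s; exact: node_rewardE.
    by apply: hA.
  have ne n (j : 'I_n.+1) : [set j] != set0 by apply/set0Pn; exists j; rewrite inE.
  split=> [n d dP | [c [k hc]]].
    have ns : (n.+1 <= dsize (enc_mx d))%N.
      by rewrite -{1}(size_enum_ord n.+1); apply: ltnW; exact: size_enc_seq.
    have [T hT] := @reduction_approximates R rho gamma N Gam rho0 N0 rN Nr gG Gg
      n n.+1 d (fun v => [set v]) (dsize (enc_mx d)) dP (@ne n) ns ns (leqnn _)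
      A ml_init po_query (enc_ml d) (@enc_po n d)
      (silent_ml_init (exec A) po_query N0 ns (leqnn _))
      (fun P t uP tK => silent_po_query (fun v => [set v]) N0 ns ns (leqnn _) (exec A)
        ml_init po_query uP (ltnW tK))
      (always n d dP).
    apply: (@always_good_approximates _ _ _ _ _ _ _ _ T) => w /hT[q [w' [u [ev fq lq]]]].
    exists q, w', u; split=> //; first exact/ml_feasibleE.
    by move=> o /ml_feasibleE fo; rewrite !ml_latencyE; exact: lq.
  have [c' [k' hF]] : poly_bounded (total_time N (fun s => c * data_bound N s ^ k + c)%N).
    apply: total_time_poly; apply: poly_bounded_add; last exact: poly_bounded_const.
    by apply: poly_bounded_mul; [exact: poly_bounded_const|];
      apply: poly_bounded_exp; exact: data_bound_poly.
  exists c', k' => x [n [d [dP ->]]].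
  have ns : (n.+1 <= dsize (enc_mx d))%N.
    by rewrite -{1}(size_enum_ord n.+1); apply: ltnW; exact: size_enc_seq.
  apply: (tuple_run (hF _)) => w sw.
  apply: (@reduction_time R rho gamma N Gam rho0 N0 rN Nr gG Gg
      n n.+1 d (fun v => [set v]) (dsize (enc_mx d)) dP (@ne n) ns ns (leqnn _)
      A ml_init po_query (enc_ml d) (@enc_po n d)
      (silent_ml_init (exec A) po_query N0 ns (leqnn _))
      (fun P t uP tK => silent_po_query (fun v => [set v]) N0 ns ns (leqnn _) (exec A)
        ml_init po_query uP (ltnW tK))
      (always n d dP) po_input c k hc) sw => //.
  + by move=> w0 B w00 B0; exists n, d, w0, B; split.
  + by move=> P t uP tK; exact: (dsize_po (fun v => [set v]) N0 ns ns (leqnn _) P (ltnW tK)).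
exists (table mgl_init go_query (growth N)) => A hA.
split=> [n m d G [dP G0 ne] | [c [k hc]]].
  have [ns ms ds] := size_mgl_instance d G.
  have [T hT] := @reduction_approximates R rho gamma N Gam rho0 N0 rN Nr gG Gg
    n m d G (dsize (enc_mgl d G)) dP ne ns ms ds
    A mgl_init go_query (enc_mgl d G) (@enc_go n m d G)
    (silent_mgl_init G N0 ns ms ds (exec A) mgl_init go_query)
    (fun P t uP tK => silent_go_query G N0 ns ms ds (exec A) mgl_init go_query uP (ltnW tK))
    (fun w B w0 B0 => hA n m d G w B (And4 dP G0 w0 B0)).
  exact: (@always_good_approximates _ _ _ _ _ _ _ _ T).
have [c' [k' hF]] : poly_bounded (total_time N (fun s => c * data_bound N s ^ k + c)%N).
  apply: total_time_poly; apply: poly_bounded_add; last exact: poly_bounded_const.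
  by apply: poly_bounded_mul; [exact: poly_bounded_const|];
    apply: poly_bounded_exp; exact: data_bound_poly.
exists c', k' => x [n [m [d [G [[dP G0 ne] ->]]]]].
have [ns ms ds] := size_mgl_instance d G.
apply: (tuple_run (hF _)) => w sw.
apply: (@reduction_time R rho gamma N Gam rho0 N0 rN Nr gG Gg
    n m d G (dsize (enc_mgl d G)) dP ne ns ms ds
    A mgl_init go_query (enc_mgl d G) (@enc_go n m d G)
    (silent_mgl_init G N0 ns ms ds (exec A) mgl_init go_query)
    (fun P t uP tK => silent_go_query G N0 ns ms ds (exec A) mgl_init go_query uP (ltnW tK))
    (fun w B w0 B0 => hA n m d G w B (And4 dP G0 w0 B0)) go_input c k hc) sw => //.
- by move=> w0 B w00 B0; exists n, m, d, G, w0, B; split.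
- by move=> P t uP tK; exact: (dsize_go G N0 ns ms ds P (ltnW tK)).
Qed.
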